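(* Let $m,n$ be coprime integers with $1\le m\le n-1$, and let $\gamma_0(x)=(\cos 2\pi x,\sin2\pi x)$ parametrize the unit circle. For every $\rho>0$ and every $\varepsilon>0$ there is a $1$-periodic real-analytic map $\gamma:\mathbb{R}\to\mathbb{R}^2$ with the following properties: - $\gamma$ extends holomorphically to the strip $\mathbb{R}+i[-\rho,\rho]$ with $\sup_{x\in\mathbb{R}+i[-\rho,\rho]}\|\gamma(x)-\gamma_0(x)\|<\varepsilon$; - $\gamma$ parametrizes a simple closed curve $\Gamma$ bounding a strictly convex domain; - $\Gamma$ admits infinitely many non-Birkhoff periodic billiard orbits of rotation number $\frac mn$.
   Context: A billiard orbit on $\Gamma$ is a sequence $z\in\Gamma^{\mathbb{Z}}$ with $z_i\ne z_{i+1}$ such that the reflection law (angle of incidence equals angle of reflection with respect to the tangent at $z_i$) holds at every $z_i$. A lift $x$ satisfies $\gamma(x_i)=z_i$ and $0<x_{i+1}-x_i<1$. The rotation number is $\lim x_i/i$. A billiard orbit is Birkhoff if its lift satisfies $x_i\le x_j+l\Rightarrow x_{i+m}\le x_{j+m}+l$ for all integers $i,j,l,m$, and non-Birkhoff otherwise. *)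

(* Defs.v *)
From Stdlib Require Import Reals ZArith.
From Coquelicot Require Import Coquelicot.
Open Scope R_scope.

Definition pt := (R * R)%type.
Definition dot (u v : pt) : R := fst u * fst v + snd u * snd v.
Definition vsub (u v : pt) : pt := (fst u - fst v, snd u - snd v).
Definition vnorm (u : pt) : R := sqrt (dot u u).
Definition unitv (u : pt) : pt := (fst u / vnorm u, snd u / vnorm u).
Definition comb (t : R) (p q : pt) : pt :=
  ((1 - t) * fst p + t * fst q, (1 - t) * snd p + t * snd q).

Definition gamma0 (x : R) : pt := (cos (2 * PI * x), sin (2 * PI * x)).

Definition Ccos (z : C) : C := (cos (Re z) * cosh (Im z), - (sin (Re z) * sinh (Im z))).
Definition Csin (z : C) : C := (sin (Re z) * cosh (Im z), cos (Re z) * sinh (Im z)).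

Definition gamma0C1 (z : C) : C := Ccos (RtoC (2 * PI) * z).
Definition gamma0C2 (z : C) : C := Csin (RtoC (2 * PI) * z).

Definition C2norm (a b : C) : R := sqrt (Cmod a ^ 2 + Cmod b ^ 2).

Definition Cholo_at (f : C -> C) (z : C) : Prop :=
  ex_derive (K := C_AbsRing) (V := C_NormedModule) f z.

(* gamma extends holomorphically to the closed strip R + i[-rho, rho]
   (i.e. to an open neighbourhood |Im z| < rho' of it, rho' > rho), and the
   supremum over the closed strip of ||gamma - gamma0|| is < eps. *)
Definition holo_close_on_strip (gamma : R -> pt) (rho eps : R) : Prop :=
  exists (G1 G2 : C -> C) (rho' : R),
    rho < rho' /\
    (forall z : C, Rabs (Im z) < rho' -> Cholo_at G1 z /\ Cholo_at G2 z) /\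
    (forall x : R, G1 (RtoC x) = RtoC (fst (gamma x)) /\
                   G2 (RtoC x) = RtoC (snd (gamma x))) /\
    exists delta : R, delta < eps /\
      forall z : C, Rabs (Im z) <= rho ->
        C2norm (Cminus (G1 z) (gamma0C1 z)) (Cminus (G2 z) (gamma0C2 z)) <= delta.

Definition on_curve (gamma : R -> pt) (p : pt) : Prop := exists t, gamma t = p.

Definition dgamma (gamma : R -> pt) (t : R) : pt :=
  (Derive (fun s => fst (gamma s)) t, Derive (fun s => snd (gamma s)) t).

Definition simple_closed_param (gamma : R -> pt) : Prop :=
  (forall x, gamma (x + 1) = gamma x) /\
  (forall x, continuous (fun s => fst (gamma s)) x /\
             continuous (fun s => snd (gamma s)) x) /\
  (forall s t, 0 <= s < 1 -> 0 <= t < 1 -> gamma s = gamma t -> s = t) /\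
  (forall x, ex_derive (fun s => fst (gamma s)) x /\
             ex_derive (fun s => snd (gamma s)) x /\
             dgamma gamma x <> (0, 0)).

Definition open2 (D : pt -> Prop) : Prop :=
  forall p, D p -> exists r, 0 < r /\ forall q, vnorm (vsub q p) < r -> D q.
Definition closure2 (D : pt -> Prop) (p : pt) : Prop :=
  forall r, 0 < r -> exists q, D q /\ vnorm (vsub q p) < r.
Definition bounded2 (D : pt -> Prop) : Prop :=
  exists M, forall p, D p -> vnorm p <= M.

Definition strictly_convex_domain (D : pt -> Prop) : Prop :=
  open2 D /\ bounded2 D /\ (exists p, D p) /\
  forall p q t, closure2 D p -> closure2 D q -> p <> q -> 0 < t < 1 -> D (comb t p q).

(* Gamma bounds D: the boundary (closure minus D, D open) of D equals Gamma. *)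
Definition bounds (gamma : R -> pt) (D : pt -> Prop) : Prop :=
  forall p, (closure2 D p /\ ~ D p) <-> on_curve gamma p.

(* Billiard orbit on Gamma: z_i in Gamma, z_i <> z_{i+1}, and the reflection law
   at z_i: the incoming unit direction (z_i - z_{i-1}) and the outgoing unit
   direction (z_{i+1} - z_i) make equal angles with the tangent at z_i. *)
Definition billiard_orbit (gamma : R -> pt) (z : Z -> pt) : Prop :=
  forall i : Z,
    on_curve gamma (z i) /\
    z i <> z (i + 1)%Z /\
    forall t, gamma t = z i ->
      dot (unitv (vsub (z i) (z (i - 1)%Z))) (dgamma gamma t)
      = dot (unitv (vsub (z (i + 1)%Z) (z i))) (dgamma gamma t).

Definition is_lift (gamma : R -> pt) (z : Z -> pt) (x : Z -> R) : Prop :=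
  forall i : Z, gamma (x i) = z i /\ 0 < x (i + 1)%Z - x i < 1.

Definition has_rotation_number (x : Z -> R) (r : R) : Prop :=
  is_lim_seq (fun k : nat => x (Z.of_nat k) / INR k) (Finite r).

Definition birkhoff_lift (x : Z -> R) : Prop :=
  forall i j l m : Z, x i <= x j + IZR l -> x (i + m)%Z <= x (j + m)%Z + IZR l.

Definition periodic_seq (z : Z -> pt) : Prop :=
  exists p : Z, (0 < p)%Z /\ forall i, z (i + p)%Z = z i.

Definition nonBirkhoff_periodic_orbit (gamma : R -> pt) (r : R) (z : Z -> pt) : Prop :=
  billiard_orbit gamma z /\ periodic_seq z /\
  exists x : Z -> R, is_lift gamma z x /\ has_rotation_number x r /\ ~ birkhoff_lift x.

(* Main.v *)
Require Import Defs.
From Stdlib Require Import Reals ZArith Lra Lia Psatz IndefiniteDescription.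
From Coquelicot Require Import Coquelicot.
Open Scope R_scope.

(** Take for [Gamma] the curve with support function [1 - d cos(n t)], [d] small:
    it is close to the circle on any strip and invariant under the dihedral group
    of order [2n].  Writing the angles of an orbit as [y_i + 2 pi i m / n], the
    rotational symmetry makes the equations for [y] autonomous; [y = 0] and
    [y = pi/n] are constant solutions, the second with longer chords.
    Maximize the length of the chains [y_0 = 0, ..., y_N = 0] with all [y_i] in
    [[0, pi/n]].  By the twist property a maximizer can touch the boundary of this
    box only if it is constant, and for [N] large it is not [0], because staying
    at [pi/n] is longer.  So it is an interior critical point, and by the
    reflection symmetry it extends to an odd solution of period [2N].  It is
    non-Birkhoff for [N > n]: a Birkhoff periodic orbit of rotation number [m/n]
    satisfies [y_(i+n) = y_i], whereas [y_n > 0 = y_0]. *)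

(** * Holomorphy of the trigonometric functions *)

(** Prescribing the support function makes all tangent lines explicit: convexity, injectivity and
    positivity of chords reduce to one lower bound for the distance from a point of the curve to a
    tangent line. The cube in [4 * w ^ 3 * d <= 1] is the price of that bound; closeness on the
    strip costs an exponential in [rho * (1 + w)]. Both only shrink [d]. Two obstacles shape the
    variational part: a maximizer over a box need not be critical, and a chain pinned at 0 may be
    constantly 0. At a wall of the box the derivative has the wrong sign unless both neighbours lie
    on that wall too, so one contact would spread to the whole chain. Against the zero chain, an
    excursion to [PI / w] loses at most two chords, a fixed amount, and gains a fixed positive
    amount per step. The pinned ends carry no critical equation; there the reflection law comes from
    the mirror axis through the point of angle 0. Different [N] give different orbits, since the
    shorter chain is back at 0 at an index where the longer one is still positive. *)

Lemma Rabs_sin_le (x : R) : Rabs (sin x) <= Rabs x.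
Proof.
  destruct (MVT_gen sin 0 x cos) as [c [_ Hc]].
  - intros y _. apply is_derive_Reals, derivable_pt_lim_sin.
  - intros y _. apply continuity_sin.
  - rewrite sin_0, !Rminus_0_r in Hc. rewrite Hc, Rabs_mult.
    assert (Rabs (cos c) <= 1) by (apply Rabs_le, COS_bound).
    pose proof (Rabs_pos x). nra.
Qed.

Lemma one_minus_cos (x : R) : 1 - cos x = 2 * sin (x / 2) ^ 2.
Proof.
  replace x with (2 * (x / 2)) at 1 by field. rewrite cos_2a_sin. ring.
Qed.

Lemma one_minus_cos_le (x : R) : 0 <= 1 - cos x <= x ^ 2 / 2.
Proof.
  rewrite one_minus_cos. pose proof (Rabs_sin_le (x / 2)) as H.
  apply Rsqr_le_abs_1 in H. unfold Rsqr in H. split; nra.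
Qed.

Lemma Rabs_sin_sub_le (y : R) : Rabs y <= 1 -> Rabs (sin y - y) <= y ^ 2.
Proof.
  intros Hy.
  destruct (MVT_gen (fun u => sin u - u) 0 y (fun u => cos u - 1)) as [c [Hc1 Hc]].
  - intros u _. auto_derive; [easy | ring].
  - intros u _. apply derivable_continuous_pt. apply ex_derive_Reals_0. now auto_derive.
  - rewrite sin_0, !Rminus_0_r in Hc. rewrite Hc, Rabs_mult.
    assert (Hcy : Rabs c <= Rabs y).
    { unfold Rmin, Rmax in Hc1. destruct (Rle_dec 0 y).
      - rewrite !Rabs_pos_eq; lra.
      - rewrite !Rabs_left1; lra. }
    assert (Rabs (cos c - 1) <= Rabs y).
    { pose proof (one_minus_cos_le c) as H. rewrite Rabs_left1 by lra.
      rewrite <- (pow2_abs c) in H. pose proof (Rabs_pos c). nra. }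
    rewrite <- (pow2_abs y). pose proof (Rabs_pos y). nra.
Qed.

Lemma exp_sub_le (x : R) : Rabs x <= 1 / 2 -> 0 <= exp x - 1 - x <= 2 * x ^ 2.
Proof.
  intros Hx. apply Rabs_le_between in Hx. split.
  - pose proof (exp_ineq1_le x). lra.
  - pose proof (exp_ineq1_le (- x)) as H. rewrite exp_Ropp in H.
    pose proof (exp_pos x) as He.
    assert (exp x * (1 - x) <= 1).
    { apply Rmult_le_compat_l with (r := exp x) in H; [|lra].
      rewrite Rinv_r in H by lra. lra. }
    nra.
Qed.

Definition Cexp (z : C) : C := (exp (Re z) * cos (Im z), exp (Re z) * sin (Im z)).

Lemma Cexp_plus (z w : C) : Cexp (z + w) = (Cexp z * Cexp w)%C.
Proof.
  destruct z as [a b], w as [a' b']. unfold Cexp, Cplus, Cmult; simpl.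
  rewrite exp_plus, cos_plus, sin_plus. f_equal; ring.
Qed.

Lemma Cmod_le_abs (z : C) : Cmod z <= Rabs (Re z) + Rabs (Im z).
Proof.
  unfold Cmod, Re, Im. pose proof (Rabs_pos (fst z)). pose proof (Rabs_pos (snd z)).
  apply Rsqr_incr_0_var; [|lra]. rewrite Rsqr_sqrt by nra. unfold Rsqr.
  rewrite <- (pow2_abs (fst z)), <- (pow2_abs (snd z)). nra.
Qed.

(** A quadratic remainder is all that differentiability at 0 requires. The constant 7 is 2 + 1 for
    the real part plus 2 + 1 + 1 for the imaginary part. *)
Lemma Cexp_sub_le (h : C) :
  Cmod h <= 1 / 2 -> Cmod (Cexp h - 1 - h)%C <= 7 * Cmod h ^ 2.
Proof.
  intros Hh. destruct h as [x y].
  pose proof (Cmod_ge_0 (x, y)) as H0.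
  assert (Hx : Rabs x <= Cmod (x, y)) by (eapply Rle_trans; [|apply Rmax_Cmod]; apply Rmax_l).
  assert (Hy : Rabs y <= Cmod (x, y)) by (eapply Rle_trans; [|apply Rmax_Cmod]; apply Rmax_r).
  set (r := Cmod (x, y)) in *.
  pose proof (Rabs_pos x). pose proof (Rabs_pos y).
  destruct (exp_sub_le x) as [E1 E2]; [lra|].
  pose proof (Rabs_sin_sub_le y ltac:(lra)) as S1.
  pose proof (Rabs_sin_le y) as S2.
  destruct (one_minus_cos_le y) as [C1 C2].
  assert (Hx2 : x ^ 2 <= r ^ 2) by (rewrite <- pow2_abs; apply pow_incr; lra).
  assert (Hy2 : y ^ 2 <= r ^ 2) by (rewrite <- pow2_abs; apply pow_incr; lra).
  eapply Rle_trans; [apply Cmod_le_abs|]. unfold Cexp; simpl.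
  replace (exp x * cos y + - (1) + - x)
    with ((exp x - 1 - x) * cos y + (1 + x) * (cos y - 1)) by ring.
  replace (exp x * sin y + - 0 + - y)
    with ((exp x - 1 - x) * sin y + x * sin y + (sin y - y)) by ring.
  assert (A1 : Rabs ((exp x - 1 - x) * cos y) <= 2 * r ^ 2).
  { rewrite Rabs_mult, (Rabs_pos_eq (exp x - 1 - x)) by lra.
    assert (Rabs (cos y) <= 1) by (apply Rabs_le, COS_bound).
    pose proof (Rabs_pos (cos y)). nra. }
  assert (A2 : Rabs ((1 + x) * (cos y - 1)) <= r ^ 2).
  { rewrite Rabs_mult, (Rabs_left1 (cos y - 1)) by lra.
    assert (Rabs (1 + x) <= 3 / 2) by (apply Rabs_le; apply Rabs_le_between in Hx; lra).
    pose proof (Rabs_pos (1 + x)). nra. }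
  assert (A3 : Rabs ((exp x - 1 - x) * sin y) <= 2 * r ^ 2).
  { rewrite Rabs_mult, (Rabs_pos_eq (exp x - 1 - x)) by lra.
    assert (Rabs (sin y) <= 1) by (apply Rabs_le, SIN_bound).
    pose proof (Rabs_pos (sin y)). nra. }
  assert (A4 : Rabs (x * sin y) <= r ^ 2).
  { rewrite Rabs_mult. pose proof (Rabs_pos (sin y)).
    simpl; rewrite Rmult_1_r; apply Rmult_le_compat; lra. }
  pose proof (Rabs_triang ((exp x - 1 - x) * cos y) ((1 + x) * (cos y - 1))).
  pose proof (Rabs_triang ((exp x - 1 - x) * sin y + x * sin y) (sin y - y)).
  pose proof (Rabs_triang ((exp x - 1 - x) * sin y) (x * sin y)).
  lra.
Qed.

Notation CV := (AbsRing_NormedModule C_AbsRing).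

Lemma is_derive_Cexp (z : C) : @is_derive C_AbsRing CV Cexp z (Cexp z).
Proof.
  split; [apply is_linear_scal_l|].
  intros x Hx.
  apply (@is_filter_lim_locally_unique C_AbsRing CV) in Hx. subst x.
  intros eps.
  pose proof (Cmod_ge_0 (Cexp z)) as HM. set (M := Cmod (Cexp z)) in *.
  (* The bound 1/2 is the range of [Cexp_sub_le]; [M + 1] replaces [M] to keep the denominator
     visibly positive. *)
  assert (Hd : 0 < Rmin (1 / 2) (eps / (7 * (M + 1)))).
  { apply Rmin_pos; [lra|]. apply Rdiv_lt_0_compat; [apply cond_pos|lra]. }
  exists (mkposreal _ Hd). intros y Hy.
  change (Cmod (y - z)%C < Rmin (1 / 2) (eps / (7 * (M + 1)))) in Hy.
  change (Cmod (Cexp y - Cexp z - (y - z) * Cexp z)%C <= eps * Cmod (y - z)%C).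
  set (h := (y - z)%C) in *.
  replace y with (z + h)%C by (unfold h; ring).
  rewrite Cexp_plus.
  replace (Cexp z * Cexp h - Cexp z - h * Cexp z)%C
    with (Cexp z * (Cexp h - 1 - h))%C by ring.
  rewrite Cmod_mult. fold M.
  assert (Hy1 : Cmod h < 1 / 2) by (eapply Rlt_le_trans; [apply Hy | apply Rmin_l]).
  assert (Hy2 : Cmod h < eps / (7 * (M + 1))) by (eapply Rlt_le_trans; [apply Hy | apply Rmin_r]).
  pose proof (Cexp_sub_le h ltac:(lra)) as HE. pose proof (Cmod_ge_0 h).
  apply (Rmult_lt_compat_r (7 * (M + 1))) in Hy2; [|lra].
  unfold Rdiv in Hy2. rewrite Rmult_assoc, Rinv_l, Rmult_1_r in Hy2 by lra.
  pose proof (Cmod_ge_0 (Cexp h - 1 - h)%C).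
  apply Rle_trans with (M * (7 * Cmod h ^ 2)); [apply Rmult_le_compat_l; lra|].
  nra.
Qed.

(** Euler's formula: both the holomorphy of [Ccos] and its growth on strips are inherited from
    [Cexp]. *)
Lemma Ccos_Cexp (z : C) : Ccos z = ((Cexp (Ci * z) + Cexp (- Ci * z)) * RtoC (/ 2))%C.
Proof.
  destruct z as [a b]. unfold Ccos, Cexp, Ci, cosh, sinh; simpl.
  unfold Cplus, Cmult; simpl.
  replace (0 * a - 1 * b) with (- b) by ring.
  replace (0 * b + 1 * a) with a by ring.
  replace (- 0 * a - -(1) * b) with b by ring.
  replace (- 0 * b + -(1) * a) with (- a) by ring.
  rewrite cos_neg, sin_neg. f_equal; field.
Qed.

Lemma Csin_Cexp (z : C) : Csin z = ((Cexp (Ci * z) - Cexp (- Ci * z)) * (- Ci * RtoC (/ 2)))%C.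
Proof.
  destruct z as [a b]. unfold Csin, Cexp, Ci, cosh, sinh; simpl.
  unfold Cminus, Cplus, Copp, Cmult; simpl.
  replace (0 * a - 1 * b) with (- b) by ring.
  replace (0 * b + 1 * a) with a by ring.
  replace (- 0 * a - -(1) * b) with b by ring.
  replace (- 0 * b + -(1) * a) with (- a) by ring.
  rewrite cos_neg, sin_neg. f_equal; field.
Qed.

(** The target carries the structure that [C] has as a ring with absolute value, the one in which
    the product and chain rules are stated. *)
Definition holo (f : C -> C) (z : C) : Prop := @ex_derive C_AbsRing CV f z.

(* [Cholo_at] mentions another uniform structure on [C], with the same norm. *)
Lemma holo_Cholo_at (f : C -> C) (z : C) : holo f z -> Cholo_at f z.
Proof.
  intros [l [[H1 H2 [M HM]] H3]]. exists l. split; [split; [exact H1 | exact H2 |]|exact H3].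
  exists M. exact HM.
Qed.

Lemma holo_ext (f g : C -> C) (z : C) : (forall u, f u = g u) -> holo f z -> holo g z.
Proof. intros H. apply (@ex_derive_ext C_AbsRing CV). exact H. Qed.

Lemma holo_const (c z : C) : holo (fun _ => c) z.
Proof. exact (@ex_derive_const C_AbsRing CV c z). Qed.

Lemma holo_id (z : C) : holo (fun u => u) z.
Proof. exact (@ex_derive_id C_AbsRing z). Qed.

Lemma holo_plus (f g : C -> C) (z : C) :
  holo f z -> holo g z -> holo (fun u => f u + g u)%C z.
Proof. exact (@ex_derive_plus C_AbsRing CV f g z). Qed.

Lemma holo_mult (f g : C -> C) (z : C) :
  holo f z -> holo g z -> holo (fun u => f u * g u)%C z.
Proof.
  intros [df Hf] [dg Hg]. eexists.
  apply (@is_derive_mult C_AbsRing f g z df dg Hf Hg). intros; apply Cmult_comm.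
Qed.

Lemma holo_minus (f g : C -> C) (z : C) :
  holo f z -> holo g z -> holo (fun u => f u - g u)%C z.
Proof. exact (@ex_derive_minus C_AbsRing CV f g z). Qed.

Lemma holo_Cexp_comp (f : C -> C) (z : C) : holo f z -> holo (fun u => Cexp (f u)) z.
Proof.
  intros [df Hf]. eexists.
  exact (@is_derive_comp C_AbsRing CV Cexp f z _ df (is_derive_Cexp (f z)) Hf).
Qed.

Lemma holo_Ccos_comp (f : C -> C) (z : C) : holo f z -> holo (fun u => Ccos (f u)) z.
Proof.
  intros Hf. eapply holo_ext; [intros u; symmetry; apply Ccos_Cexp|].
  apply holo_mult; [apply holo_plus|apply holo_const];
    apply holo_Cexp_comp, holo_mult; auto using holo_const.
Qed.

Lemma holo_Csin_comp (f : C -> C) (z : C) : holo f z -> holo (fun u => Csin (f u)) z.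
Proof.
  intros Hf. eapply holo_ext; [intros u; symmetry; apply Csin_Cexp|].
  apply holo_mult; [apply holo_minus|apply holo_const];
    apply holo_Cexp_comp, holo_mult; auto using holo_const.
Qed.

Lemma Cmod_Cexp (z : C) : Cmod (Cexp z) = exp (Re z).
Proof.
  unfold Cmod, Cexp; simpl.
  replace (_ + _) with (exp (Re z) ^ 2 * (sin (Im z) ^ 2 + cos (Im z) ^ 2)) by ring.
  rewrite <- !Rsqr_pow2, sin2_cos2, Rmult_1_r.
  apply sqrt_Rsqr. left; apply exp_pos.
Qed.

Lemma exp_le_mono (x y : R) : x <= y -> exp x <= exp y.
Proof. intros [H | ->]; [left; now apply exp_increasing | lra]. Qed.

Lemma Cmod_Ccos_le (z : C) : Cmod (Ccos z) <= exp (Rabs (Im z)).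
Proof.
  rewrite Ccos_Cexp, Cmod_mult, Cmod_R, Rabs_pos_eq by lra.
  pose proof (Cmod_triangle (Cexp (Ci * z)) (Cexp (- Ci * z))) as H.
  rewrite !Cmod_Cexp in H. simpl in H.
  assert (exp (0 * fst z - 1 * snd z) <= exp (Rabs (Im z))).
  { apply exp_le_mono. pose proof (Rle_abs (- snd z)) as Ha. rewrite Rabs_Ropp in Ha. unfold Im. lra. }
  assert (exp (- 0 * fst z - - (1) * snd z) <= exp (Rabs (Im z))).
  { apply exp_le_mono. pose proof (Rle_abs (snd z)). unfold Im. lra. }
  unfold Re, Im in *. lra.
Qed.

Lemma Cmod_Csin_le (z : C) : Cmod (Csin z) <= exp (Rabs (Im z)).
Proof.
  rewrite Csin_Cexp, !Cmod_mult, Cmod_opp, Cmod_Ci, Cmod_R, Rabs_pos_eq by lra.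
  pose proof (Cmod_triangle (Cexp (Ci * z)) (- Cexp (- Ci * z))) as H.
  rewrite Cmod_opp, !Cmod_Cexp in H. simpl in H.
  assert (exp (0 * fst z - 1 * snd z) <= exp (Rabs (Im z))).
  { apply exp_le_mono. pose proof (Rle_abs (- snd z)) as Ha. rewrite Rabs_Ropp in Ha. unfold Im. lra. }
  assert (exp (- 0 * fst z - - (1) * snd z) <= exp (Rabs (Im z))).
  { apply exp_le_mono. pose proof (Rle_abs (snd z)). unfold Im. lra. }
  unfold Cminus, Re, Im in *. lra.
Qed.

(** * The curve and the convex domain it bounds *)

Lemma Rabs_sin_mult_le (k : nat) (v : R) : Rabs (sin (INR k * v)) <= INR k * Rabs (sin v).
Proof.
  induction k as [|k IH].
  - simpl. rewrite Rmult_0_l, sin_0, Rabs_R0. lra.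
  - rewrite S_INR, Rmult_plus_distr_r, Rmult_1_l, sin_plus.
    eapply Rle_trans; [apply Rabs_triang|]. rewrite !Rabs_mult.
    assert (Rabs (cos v) <= 1) by (apply Rabs_le, COS_bound).
    assert (Rabs (cos (INR k * v)) <= 1) by (apply Rabs_le, COS_bound).
    pose proof (Rabs_pos (sin v)). pose proof (Rabs_pos (sin (INR k * v))).
    pose proof (Rabs_pos (cos v)). nra.
Qed.

Lemma one_minus_cos_mult_le (k : nat) (u : R) :
  1 - cos (INR k * u) <= INR k ^ 2 * (1 - cos u).
Proof.
  rewrite (one_minus_cos (INR k * u)), (one_minus_cos u).
  replace (INR k * u / 2) with (INR k * (u / 2)) by field.
  pose proof (Rabs_sin_mult_le k (u / 2)) as H.
  rewrite <- (pow2_abs (sin (INR k * _))), <- (pow2_abs (sin (u / 2))).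
  pose proof (pow_incr _ _ 2 (conj (Rabs_pos _) H)) as H2. rewrite Rpow_mult_distr in H2. lra.
Qed.

(** The error is measured by [1 - cos u], the quantity with which [gap] is compared later. The cube
    closes the induction, because k^3 + k^2 + k <= (k + 1)^3. *)
Lemma sin_mult_sub_le (k : nat) (u : R) :
  Rabs (sin (INR k * u) - INR k * sin u) <= INR k ^ 3 * (1 - cos u).
Proof.
  induction k as [|k IH].
  - simpl. rewrite !Rmult_0_l, sin_0, Rminus_0_r, Rabs_R0. lra.
  - rewrite S_INR, Rmult_plus_distr_r, Rmult_1_l, sin_plus.
    pose proof (pos_INR k) as Hk. set (r := INR k) in *.
    replace (sin (r * u) * cos u + cos (r * u) * sin u - (r + 1) * sin u)
      with ((sin (r * u) - r * sin u) * cos u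
            + sin u * ((cos (r * u) - 1) + r * (cos u - 1))) by ring.
    eapply Rle_trans; [apply Rabs_triang|]. rewrite !Rabs_mult.
    pose proof (COS_bound u). pose proof (COS_bound (r * u)).
    assert (Rabs (cos u) <= 1) by (apply Rabs_le, COS_bound).
    assert (Rabs (sin u) <= 1) by (apply Rabs_le, SIN_bound).
    pose proof (one_minus_cos_mult_le k u) as Hc. fold r in Hc.
    rewrite (Rabs_left1 (cos (r * u) - 1 + _)) by nra.
    pose proof (Rabs_pos (cos u)). pose proof (Rabs_pos (sin u)).
    pose proof (Rabs_pos (sin (r * u) - r * sin u)).
    assert (Rabs (sin (r * u) - r * sin u) * Rabs (cos u) <= r ^ 3 * (1 - cos u)) by nra.
    assert (Rabs (sin u) * - (cos (r * u) - 1 + r * (cos u - 1))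
            <= (r ^ 2 + r) * (1 - cos u)).
    { apply Rle_trans with (1 * - (cos (r * u) - 1 + r * (cos u - 1))); [|nra].
      apply Rmult_le_compat_r; nra. }
    assert (0 <= r ^ 2) by nra.
    nra.
Qed.

(** * Curves given by a support function *)

Definition supp (w d t : R) : R := 1 - d * cos (w * t).
Definition supp' (w d t : R) : R := d * w * sin (w * t).
(** This is [supp] plus its second derivative. *)
Definition rad (w d t : R) : R := 1 + d * (w ^ 2 - 1) * cos (w * t).

(* The curve with support function [supp]: its tangent at parameter [t] is
   directed by [tang t], and its radius of curvature there is [rad t]. *)
Definition crv (w d t : R) : pt :=
  (supp w d t * cos t - supp' w d t * sin t, supp w d t * sin t + supp' w d t * cos t).
Definition tang (t : R) : pt := (- sin t, cos t).
Definition norml (t : R) : pt := (cos t, sin t).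
(** Signed distance from the point at [s] to the tangent line at [t]; equivalently, the normal
    component at [t] of the chord joining the two points. *)
Definition gap (w d s t : R) : R := supp w d t - dot (crv w d s) (norml t).

(** Integrality of [w] closes the curve after one turn. The smallness condition bounds two error
    terms in [gap], each at most [w ^ 3 * d * (1 - cos (t - s))], by half of the circle's value in
    total. *)
Definition admissible (w d : R) : Prop :=
  0 < d /\ 4 * w ^ 3 * d <= 1 /\ exists k : nat, (1 <= k)%nat /\ w = INR k.

Lemma admissible_w_ge1 (w d : R) : admissible w d -> 1 <= w.
Proof.
  intros (_ & _ & k & Hk & ->). apply le_INR in Hk. simpl in Hk. lra.
Qed.

Lemma admissible_d_lt1 (w d : R) : admissible w d -> 4 * d <= 1.
Proof.
  intros H. pose proof (admissible_w_ge1 w d H). destruct H as (Hd0 & Hd1 & _).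
  assert (1 <= w ^ 3) by (apply pow_R1_Rle; lra). nra.
Qed.

Lemma supp_pos (w d t : R) : admissible w d -> 0 < supp w d t <= 2.
Proof.
  intros H. pose proof (admissible_d_lt1 w d H). destruct H as (Hd0 & _).
  unfold supp. pose proof (COS_bound (w * t)). split; nra.
Qed.

Lemma rad_pos (w d t : R) : admissible w d -> 0 < rad w d t <= 2.
Proof.
  intros H. pose proof (admissible_w_ge1 w d H). pose proof (admissible_d_lt1 w d H).
  destruct H as (Hd0 & Hd1 & _).
  unfold rad. pose proof (COS_bound (w * t)).
  assert (0 <= d * (w ^ 2 - 1) <= / 4).
  { split; [apply Rmult_le_pos; nra|].
    assert (w ^ 2 <= w ^ 3) by (apply Rle_pow; [lra|lia]). nra. }
  split; nra.
Qed.

(** For the circle the gap is exactly [1 - cos (t - s)], and the perturbation costs at most half of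
    it. This is strict convexity in quantitative form: a point of the curve meets only its own
    tangent line. *)
Lemma gap_lower (w d s t : R) :
  admissible w d -> (1 - cos (t - s)) / 2 <= gap w d s t.
Proof.
  intros H. pose proof (admissible_w_ge1 w d H) as Hw.
  destruct H as (Hd0 & Hd1 & k & Hk & Ek).
  set (u := t - s).
  pose proof (one_minus_cos_mult_le k u) as B1.
  pose proof (sin_mult_sub_le k u) as B2. rewrite <- Ek in B1, B2.
  assert (E : gap w d s t = (1 - cos u)
    - d * (cos (w * s) * (cos (w * u) - cos u) - sin (w * s) * (sin (w * u) - w * sin u))).
  { unfold gap, dot, crv, norml, supp, supp'; simpl.
    replace (w * t) with (w * s + w * u) by (unfold u; ring).
    rewrite cos_plus.
    replace (cos u) with (cos t * cos s + sin t * sin s) by (unfold u; now rewrite cos_minus).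
    replace (sin u) with (sin t * cos s - cos t * sin s) by (unfold u; now rewrite sin_minus).
    ring. }
  rewrite E.
  pose proof (COS_bound u). pose proof (COS_bound (w * u)).
  assert (0 <= w ^ 2) by nra.
  assert (w ^ 2 <= w ^ 3) by (apply Rle_pow; [lra|lia]).
  assert (1 <= w ^ 2) by (apply pow_R1_Rle; lra).
  assert (C1 : Rabs (cos (w * s) * (cos (w * u) - cos u)) <= w ^ 3 * (1 - cos u)).
  { rewrite Rabs_mult.
    assert (Rabs (cos (w * s)) <= 1) by (apply Rabs_le, COS_bound).
    assert (Rabs (cos (w * u) - cos u) <= w ^ 3 * (1 - cos u)) by (apply Rabs_le; nra).
    pose proof (Rabs_pos (cos (w * s))). pose proof (Rabs_pos (cos (w * u) - cos u)). nra. }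
  assert (C2 : Rabs (sin (w * s) * (sin (w * u) - w * sin u)) <= w ^ 3 * (1 - cos u)).
  { rewrite Rabs_mult.
    assert (Rabs (sin (w * s)) <= 1) by (apply Rabs_le, SIN_bound).
    pose proof (Rabs_pos (sin (w * s))). pose proof (Rabs_pos (sin (w * u) - w * sin u)). nra. }
  apply Rabs_le_between in C1. apply Rabs_le_between in C2.
  set (X := cos (w * s) * _) in *. set (Y := sin (w * s) * _) in *.
  assert (d * (X - Y) <= d * (2 * w ^ 3 * (1 - cos u))) by (apply Rmult_le_compat_l; lra).
  nra.
Qed.

Lemma gap_self (w d t : R) : gap w d t t = 0.
Proof.
  unfold gap, dot, crv, norml; simpl.
  transitivity (supp w d t * (1 - (Rsqr (sin t) + Rsqr (cos t)))); [unfold Rsqr; ring|].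
  rewrite sin2_cos2. ring.
Qed.

Lemma cos_lt_1 (u : R) : 0 < u < 2 * PI -> cos u < 1.
Proof.
  intros Hu. pose proof (one_minus_cos u).
  assert (0 < sin (u / 2)) by (apply sin_gt_0; lra).
  assert (0 < sin (u / 2) ^ 2) by (apply pow_lt; lra). lra.
Qed.

Lemma is_derive_crv1 (w d t : R) :
  is_derive (fun s => fst (crv w d s)) t (- rad w d t * sin t).
Proof.
  unfold crv, rad, supp, supp'; simpl. auto_derive; [easy|]. ring.
Qed.

Lemma is_derive_crv2 (w d t : R) :
  is_derive (fun s => snd (crv w d s)) t (rad w d t * cos t).
Proof.
  unfold crv, rad, supp, supp'; simpl. auto_derive; [easy|]. ring.
Qed.

Lemma dot_norml (t : R) : dot (norml t) (norml t) = 1.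
Proof.
  unfold dot, norml; simpl. pose proof (sin2_cos2 t) as H. unfold Rsqr in H. lra.
Qed.

Lemma vnorm_ge0 (u : pt) : 0 <= vnorm u.
Proof. apply sqrt_pos. Qed.

Lemma vnorm_sqr (u : pt) : vnorm u * vnorm u = dot u u.
Proof. apply sqrt_sqrt. unfold dot. nra. Qed.

Lemma dot_le_vnorm (u v : pt) : Rabs (dot u v) <= vnorm u * vnorm v.
Proof.
  unfold vnorm. rewrite <- sqrt_mult by (unfold dot; nra).
  rewrite <- sqrt_Rsqr_abs. apply sqrt_le_1_alt. unfold Rsqr, dot.
  pose proof (Rle_0_sqr (fst u * snd v - snd u * fst v)) as H. unfold Rsqr in H. nra.
Qed.

Lemma vnorm_norml (t : R) : vnorm (norml t) = 1.
Proof. unfold vnorm. rewrite dot_norml. apply sqrt_1. Qed.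

Lemma vnorm_le_abs (u : pt) : vnorm u <= Rabs (fst u) + Rabs (snd u).
Proof.
  pose proof (Rabs_pos (fst u)). pose proof (Rabs_pos (snd u)).
  apply Rsqr_incr_0_var; [|lra]. unfold Rsqr. rewrite vnorm_sqr. unfold dot.
  pose proof (Rsqr_abs (fst u)). pose proof (Rsqr_abs (snd u)). unfold Rsqr in *. nra.
Qed.

(** * The open domain cut out by the tangent lines *)

Definition dom (w d : R) (q : pt) : Prop := forall t, dot q (norml t) < supp w d t.

Lemma norml_2PI (t : R) (k : Z) : norml (t + 2 * PI * IZR k) = norml t.
Proof.
  unfold norml. f_equal.
  - rewrite cos_plus.
    replace (2 * PI * IZR k) with (2 * (IZR k * PI)) by ring.
    rewrite sin_2a, cos_2a_sin, (sin_eq_0_1 (IZR k * PI)) by (now exists k). ring.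
  - rewrite sin_plus.
    replace (2 * PI * IZR k) with (2 * (IZR k * PI)) by ring.
    rewrite sin_2a, cos_2a_sin, (sin_eq_0_1 (IZR k * PI)) by (now exists k). ring.
Qed.

Lemma cos_2PI_Z (t : R) (k : Z) : cos (t + 2 * PI * IZR k) = cos t.
Proof. exact (f_equal fst (norml_2PI t k)). Qed.

Lemma sin_2PI_Z (t : R) (k : Z) : sin (t + 2 * PI * IZR k) = sin t.
Proof. exact (f_equal snd (norml_2PI t k)). Qed.

Lemma supp_2PI (w d t : R) (k : Z) :
  admissible w d -> supp w d (t + 2 * PI * IZR k) = supp w d t.
Proof.
  intros (_ & _ & j & _ & ->). unfold supp.
  replace (INR j * (t + 2 * PI * IZR k)) with (INR j * t + 2 * PI * IZR (Z.of_nat j * k)).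
  - now rewrite cos_2PI_Z.
  - rewrite mult_IZR, <- INR_IZR_INZ. ring.
Qed.

Lemma supp'_2PI (w d t : R) (k : Z) :
  admissible w d -> supp' w d (t + 2 * PI * IZR k) = supp' w d t.
Proof.
  intros (_ & _ & j & _ & ->). unfold supp'.
  replace (INR j * (t + 2 * PI * IZR k)) with (INR j * t + 2 * PI * IZR (Z.of_nat j * k)).
  - now rewrite sin_2PI_Z.
  - rewrite mult_IZR, <- INR_IZR_INZ. ring.
Qed.

Lemma crv_2PI (w d t : R) (k : Z) :
  admissible w d -> crv w d (t + 2 * PI * IZR k) = crv w d t.
Proof.
  intros H. unfold crv. now rewrite supp_2PI, supp'_2PI, cos_2PI_Z, sin_2PI_Z.
Qed.

Lemma reduce_2PI (t : R) : exists k : Z, 0 <= t + 2 * PI * IZR k < 2 * PI.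
Proof.
  pose proof PI_RGT_0. destruct (archimed (t / (2 * PI))) as [A1 A2].
  exists (1 - up (t / (2 * PI)))%Z. rewrite minus_IZR.
  set (q := t / (2 * PI)) in *.
  replace t with (2 * PI * q) by (unfold q; field; lra).
  split; nra.
Qed.

(** If the two points coincide, then [gap w d s t = gap w d t t = 0], and the lower bound on the gap
    forces [cos (t - s) = 1]. *)
Lemma crv_inj (w d s t : R) :
  admissible w d -> crv w d s = crv w d t -> exists k : Z, t = s + 2 * PI * IZR k.
Proof.
  intros H E. destruct (reduce_2PI (t - s)) as [k [Hk1 Hk2]].
  destruct (Req_dec (t - s + 2 * PI * IZR k) 0) as [E0|N0].
  - exists (- k)%Z. rewrite opp_IZR. lra.
  - exfalso. pose proof (cos_lt_1 (t - s + 2 * PI * IZR k) ltac:(lra)) as Hc.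
    rewrite cos_2PI_Z in Hc. pose proof (gap_lower w d s t H) as G.
    pose proof (gap_self w d t) as G0. unfold gap in G, G0. rewrite E in G. lra.
Qed.

Lemma vnorm_lt_pos (u : pt) : u <> (0, 0) -> 0 < vnorm u.
Proof.
  intros H. apply sqrt_lt_R0. unfold dot. destruct u as [a b]; simpl.
  destruct (Req_dec a 0) as [->|Ha]; [|nra].
  destruct (Req_dec b 0) as [->|Hb]; [now exfalso|nra].
Qed.

Lemma dot_vsub (p q v : pt) : dot (vsub p q) v = dot p v - dot q v.
Proof. unfold dot, vsub; simpl. ring. Qed.

(** Infinitely many strict inequalities must survive a small displacement. Their slack is continuous
    and 2 pi-periodic in [t], so it has a positive minimum, which serves as the radius. *)
Lemma dom_open (w d : R) : admissible w d -> open2 (dom w d).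
Proof.
  intros H q Hq.
  set (f := fun t => supp w d t - dot q (norml t)).
  destruct (continuity_ab_min f 0 (2 * PI)) as [t0 [Ht0 _]].
  - pose proof PI_RGT_0. lra.
  - intros t _. apply derivable_continuous_pt, ex_derive_Reals_0.
    unfold f, supp, dot, norml; simpl. now auto_derive.
  - assert (Hf : forall t, f t0 <= f t).
    { intros t. destruct (reduce_2PI t) as [k [Hk1 Hk2]].
      replace (f t) with (f (t + 2 * PI * IZR k)).
      - apply Ht0. lra.
      - unfold f. now rewrite supp_2PI, norml_2PI. }
    assert (Hp : 0 < f t0) by (unfold f; specialize (Hq t0); lra).
    exists (f t0). split; [exact Hp|]. intros q' Hq' t.
    pose proof (dot_le_vnorm (vsub q' q) (norml t)) as B.
    rewrite vnorm_norml, Rmult_1_r, dot_vsub in B. apply Rabs_le_between in B.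
    specialize (Hf t). change (f t) with (supp w d t - dot q (norml t)) in Hf. lra.
Qed.

Lemma dom_bounded (w d : R) : admissible w d -> bounded2 (dom w d).
Proof.
  intros H. exists 4. intros [a b] Hq.
  pose proof (Hq 0) as B0. pose proof (Hq PI) as B1.
  pose proof (Hq (PI / 2)) as B2. pose proof (Hq (- (PI / 2))) as B3.
  unfold dot, norml in *; simpl in *.
  rewrite ?cos_neg, ?sin_neg, ?cos_0, ?sin_0, ?cos_PI, ?sin_PI, ?cos_PI2, ?sin_PI2 in *.
  pose proof (supp_pos w d 0 H). pose proof (supp_pos w d PI H).
  pose proof (supp_pos w d (PI / 2) H). pose proof (supp_pos w d (- (PI / 2)) H).
  eapply Rle_trans; [apply vnorm_le_abs|]; simpl.
  assert (Rabs a <= 2) by (apply Rabs_le; lra).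
  assert (Rabs b <= 2) by (apply Rabs_le; lra). lra.
Qed.

Lemma closure_dom_le (w d : R) (q : pt) :
  closure2 (dom w d) q -> forall t, dot q (norml t) <= supp w d t.
Proof.
  intros Hq t. apply Rnot_lt_le. intros Hlt.
  destruct (Hq (dot q (norml t) - supp w d t)) as [q' [H1 H2]]; [lra|].
  specialize (H1 t). pose proof (dot_le_vnorm (vsub q' q) (norml t)) as B.
  rewrite vnorm_norml, Rmult_1_r, dot_vsub in B. apply Rabs_le_between in B. lra.
Qed.

(* At a contact, [supp t - <q, norml t>] is minimal, so its derivative vanishes:
   both coordinates of [q] in the moving frame are determined. *)
Lemma contact_crv (w d : R) (q : pt) (t : R) :
  (forall s, dot q (norml s) <= supp w d s) -> dot q (norml t) = supp w d t ->
  q = crv w d t.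
Proof.
  intros Hle Heq.
  set (f := fun s => supp w d s - dot q (norml s)).
  assert (Hd : is_derive f t (supp' w d t - dot q (tang t))).
  { unfold f, supp, supp', dot, norml, tang; simpl. auto_derive; [easy|]. ring. }
  assert (H0 : supp' w d t - dot q (tang t) = 0).
  { apply is_derive_Reals in Hd.
    pose (pr := exist _ _ Hd : derivable_pt f t).
    change (derive_pt f t pr = 0).
    apply (deriv_minimum f (t - 1) (t + 1)); [lra|lra|].
    intros s _ _. unfold f. rewrite Heq. specialize (Hle s). lra. }
  destruct q as [a b]. unfold crv. unfold dot, norml, tang in *; simpl in *.
  rewrite <- Heq. replace (supp' w d t) with (a * - sin t + b * cos t) by lra.
  pose proof (sin2_cos2 t) as S. unfold Rsqr in S.
  f_equal.
  - transitivity (a * (sin t * sin t + cos t * cos t)); [rewrite S|]; ring.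
  - transitivity (b * (sin t * sin t + cos t * cos t)); [rewrite S|]; ring.
Qed.

Lemma not_dom_contact (w d : R) (q : pt) :
  (forall s, dot q (norml s) <= supp w d s) -> ~ dom w d q ->
  exists t, dot q (norml t) = supp w d t.
Proof.
  intros Hle Hn. apply Classical_Pred_Type.not_all_ex_not in Hn.
  destruct Hn as [t Ht]. exists t. specialize (Hle t). lra.
Qed.

(** If an inner point of a segment is outside the domain, it touches a supporting line; both ends
    then lie on that line, and a supporting line has only one contact point. *)
Lemma dom_strictly_convex (w d : R) : admissible w d -> strictly_convex_domain (dom w d).
Proof.
  intros H. repeat split; [now apply dom_open|now apply dom_bounded| |].
  - exists (0, 0). intros t. unfold dot; simpl. pose proof (supp_pos w d t H). lra.
  - intros p q t Hp Hq Npq Ht.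
    apply Classical_Prop.NNPP. intros Hn.
    pose proof (closure_dom_le _ _ _ Hp) as Lp. pose proof (closure_dom_le _ _ _ Hq) as Lq.
    assert (E : forall s, dot (comb t p q) (norml s)
                = (1 - t) * dot p (norml s) + t * dot q (norml s))
      by (intros; unfold dot, comb; simpl; ring).
    destruct (not_dom_contact w d (comb t p q)) as [s Hs]; [|exact Hn|].
    + intros s. rewrite E. specialize (Lp s). specialize (Lq s). nra.
    + rewrite E in Hs. pose proof (Lp s). pose proof (Lq s).
      apply Npq. rewrite (contact_crv w d p s), (contact_crv w d q s); trivial; nra.
Qed.

Lemma bounds_dom (w d : R) (q : pt) :
  admissible w d ->
  (closure2 (dom w d) q /\ ~ dom w d q) <-> exists t, crv w d t = q.
Proof.
  intros H. split.
  - intros [Hc Hn]. pose proof (closure_dom_le _ _ _ Hc) as L.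
    destruct (not_dom_contact w d q L Hn) as [t Ht].
    exists t. symmetry. now apply contact_crv.
  - intros [t <-].
    assert (L : forall s, dot (crv w d t) (norml s) <= supp w d s).
    { intros s. pose proof (gap_lower w d t s H) as G. unfold gap in G.
      pose proof (COS_bound (s - t)). lra. }
    split.
    + intros r Hr. set (p := crv w d t).
      pose proof (vnorm_ge0 p) as Hp.
      (* Shrinking towards the origin by the factor [1 - e] enters the domain because [supp] is
         positive; it moves [p] by [e * vnorm p], which is less than [r]. *)
      set (e := Rmin (1 / 2) (r / (2 * (vnorm p + 1)))).
      assert (He : 0 < e) by (apply Rmin_pos; [lra|apply Rdiv_lt_0_compat; lra]).
      assert (He1 : e <= 1 / 2) by apply Rmin_l.
      assert (He2 : e * (2 * (vnorm p + 1)) <= r).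
      { apply Rle_div_r; [lra|apply Rmin_r]. }
      exists ((1 - e) * fst p, (1 - e) * snd p). split.
      * intros s. specialize (L s). fold p in L. pose proof (supp_pos w d s H).
        replace (dot ((1 - e) * fst p, (1 - e) * snd p) (norml s))
          with ((1 - e) * dot p (norml s)) by (unfold dot; simpl; ring). nra.
      * replace (vnorm _) with (e * vnorm p); [nra|].
        unfold vnorm. replace (dot (vsub _ p) (vsub _ p)) with (Rsqr e * dot p p)
          by (unfold dot, vsub, Rsqr; simpl; ring).
        rewrite sqrt_mult, sqrt_Rsqr; unfold Rsqr, dot; nra.
    + intros Hd. specialize (Hd t). pose proof (gap_self w d t) as G. unfold gap in G. lra.
Qed.

(** * Chords and their angles of incidence *)

Definition rot (b : R) (p : pt) : pt :=
  (cos b * fst p - sin b * snd p, sin b * fst p + cos b * snd p).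
Definition refl (p : pt) : pt := (fst p, - snd p).

Lemma dot_rot (b : R) (p q : pt) : dot (rot b p) (rot b q) = dot p q.
Proof.
  unfold dot, rot; simpl.
  transitivity ((Rsqr (sin b) + Rsqr (cos b)) * (fst p * fst q + snd p * snd q));
    [unfold Rsqr; ring|rewrite sin2_cos2; ring].
Qed.

Lemma dot_unitv (u v : pt) : dot (unitv u) v = dot u v / vnorm u.
Proof. unfold dot, unitv, Rdiv; simpl. ring. Qed.

Definition chord (w d s t : R) : R := vnorm (vsub (crv w d t) (crv w d s)).
(* The cosine of the angle at [crv t] between the oriented tangent and the
   chord coming from [crv s]. *)
Definition inc (w d s t : R) : R := dot (unitv (vsub (crv w d t) (crv w d s))) (tang t).

Lemma chord_sym (w d s t : R) : chord w d s t = chord w d t s.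
Proof.
  unfold chord, vnorm. f_equal. unfold dot, vsub; simpl. ring.
Qed.

Lemma crv_rot (w d t : R) (j : Z) :
  w <> 0 -> crv w d (t + 2 * PI * IZR j / w) = rot (2 * PI * IZR j / w) (crv w d t).
Proof.
  intros Hw. unfold crv, rot, supp, supp'; simpl.
  replace (w * (t + 2 * PI * IZR j / w)) with (w * t + 2 * PI * IZR j) by (now field).
  rewrite cos_2PI_Z, sin_2PI_Z, cos_plus, sin_plus. f_equal; ring.
Qed.

Lemma vsub_rot (b : R) (p q : pt) : vsub (rot b p) (rot b q) = rot b (vsub p q).
Proof. unfold vsub, rot; simpl. f_equal; ring. Qed.

Lemma tang_rot (b t : R) : tang (t + b) = rot b (tang t).
Proof. unfold tang, rot; simpl. rewrite cos_plus, sin_plus. f_equal; ring. Qed.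

Lemma chord_rot (w d s t : R) (j : Z) :
  w <> 0 ->
  chord w d (s + 2 * PI * IZR j / w) (t + 2 * PI * IZR j / w) = chord w d s t.
Proof.
  intros Hw. unfold chord, vnorm. now rewrite !crv_rot, vsub_rot, dot_rot.
Qed.

Lemma inc_rot (w d s t : R) (j : Z) :
  w <> 0 ->
  inc w d (s + 2 * PI * IZR j / w) (t + 2 * PI * IZR j / w) = inc w d s t.
Proof.
  intros Hw. unfold inc. rewrite !dot_unitv. unfold vnorm.
  now rewrite !crv_rot, vsub_rot, tang_rot, !dot_rot.
Qed.

Lemma crv_refl (w d t : R) : crv w d (- t) = refl (crv w d t).
Proof.
  unfold crv, refl, supp, supp'; simpl.
  replace (w * - t) with (- (w * t)) by ring.
  rewrite !cos_neg, !sin_neg. f_equal; ring.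
Qed.

Lemma inc_refl (w d s t : R) : inc w d (- s) (- t) = - inc w d s t.
Proof.
  unfold inc. rewrite !dot_unitv, !crv_refl.
  replace (vnorm (vsub (refl (crv w d t)) (refl (crv w d s))))
    with (vnorm (vsub (crv w d t) (crv w d s)))
    by (unfold vnorm; f_equal; unfold dot, vsub, refl; simpl; ring).
  unfold Rdiv. rewrite <- Ropp_mult_distr_l_reverse. f_equal.
  unfold dot, vsub, refl, tang; simpl. rewrite cos_neg, sin_neg. ring.
Qed.

Lemma inc_2PI (w d s t : R) (k : Z) :
  admissible w d -> inc w d (s + 2 * PI * IZR k) t = inc w d s t.
Proof. intros H. unfold inc. now rewrite crv_2PI. Qed.

Lemma dot_chord_norml (w d s t : R) :
  dot (vsub (crv w d t) (crv w d s)) (norml t) = gap w d s t.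
Proof.
  rewrite dot_vsub. unfold gap. pose proof (gap_self w d t) as G. unfold gap in G. lra.
Qed.

Lemma chord_sqr (w d s t : R) :
  chord w d s t * chord w d s t
  = dot (vsub (crv w d t) (crv w d s)) (tang t) ^ 2 + gap w d s t ^ 2.
Proof.
  unfold chord. rewrite vnorm_sqr, <- dot_chord_norml.
  generalize (vsub (crv w d t) (crv w d s)) as v. intros v. unfold dot, tang, norml; simpl.
  transitivity ((Rsqr (sin t) + Rsqr (cos t)) * (fst v * fst v + snd v * snd v));
    [rewrite sin2_cos2|unfold Rsqr]; ring.
Qed.

Lemma gap_pos (w d s t : R) : admissible w d -> cos (t - s) < 1 -> 0 < gap w d s t.
Proof. intros H Hc. pose proof (gap_lower w d s t H). lra. Qed.

Lemma chord_pos (w d s t : R) : admissible w d -> cos (t - s) < 1 -> 0 < chord w d s t.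
Proof.
  intros H Hc. pose proof (gap_pos w d s t H Hc). pose proof (chord_sqr w d s t).
  pose proof (vnorm_ge0 (vsub (crv w d t) (crv w d s))) as V. fold (chord w d s t) in V. nra.
Qed.

(** * First variation of the chord and the twist property *)

Lemma is_derive_sqdist (x y : R -> R) (t a b x' y' : R) :
  is_derive x t x' -> is_derive y t y' ->
  is_derive (fun u => (x u - a) * (x u - a) + (y u - b) * (y u - b)) t
    (2 * (x' * (x t - a) + y' * (y t - b))).
Proof.
  intros D1 D2. auto_derive.
  - repeat split; eexists; eassumption.
  - change (Derive (fun u => x u) t) with (Derive x t).
    change (Derive (fun u => y u) t) with (Derive y t).
    rewrite (is_derive_unique x t _ D1), (is_derive_unique y t _ D2). ring.
Qed.

(** Abstract coordinates [x], [y] keep the trigonometric formulas of the curve out of the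
    differentiation. *)
Lemma is_derive_frame_ratio (x y : R -> R) (s a b p c e x' y' : R) :
  is_derive x s x' -> is_derive y s y' -> p - (x s * c + y s * e) <> 0 ->
  is_derive (fun u => ((a - x u) * - e + (b - y u) * c) / (p - (x u * c + y u * e))) s
    (((x' * e - y' * c) * (p - (x s * c + y s * e))
      + (x' * c + y' * e) * ((a - x s) * - e + (b - y s) * c))
     / (p - (x s * c + y s * e)) ^ 2).
Proof.
  intros D1 D2 H. auto_derive.
  - repeat split; try (eexists; eassumption). exact H.
  - change (Derive (fun u => x u) s) with (Derive x s).
    change (Derive (fun u => y u) s) with (Derive y s).
    rewrite (is_derive_unique x s _ D1), (is_derive_unique y s _ D2). field. exact H.
Qed.

(** The gradient of a distance is the unit vector along the chord, and the curve moves with velocity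
    [rad] times [tang]. Hence critical points of the total length obey the reflection law. *)
Lemma is_derive_chord (w d s t : R) :
  admissible w d -> cos (t - s) < 1 ->
  is_derive (chord w d s) t (rad w d t * inc w d s t).
Proof.
  intros H Hc. pose proof (chord_pos w d s t H Hc) as Hp.
  unfold inc. rewrite dot_unitv. fold (chord w d s t).
  set (f := fun u => dot (vsub (crv w d u) (crv w d s)) (vsub (crv w d u) (crv w d s))).
  assert (Hf : is_derive f t
    (2 * rad w d t * dot (vsub (crv w d t) (crv w d s)) (tang t))).
  { pose proof (is_derive_sqdist _ _ t (fst (crv w d s)) (snd (crv w d s)) _ _
      (is_derive_crv1 w d t) (is_derive_crv2 w d t)) as D.
    unfold f, dot, vsub; simpl fst; simpl snd.
    eapply (eq_ind _ (is_derive _ t) D). unfold tang; simpl; ring. }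
  change (is_derive (fun u => sqrt (f u)) t
    (rad w d t * (dot (vsub (crv w d t) (crv w d s)) (tang t) / chord w d s t))).
  assert (E : sqrt (f t) = chord w d s t) by reflexivity.
  assert (Hft : 0 < f t).
  { unfold f. rewrite <- vnorm_sqr. fold (chord w d s t). nra. }
  replace (rad w d t * _) with
    (2 * rad w d t * dot (vsub (crv w d t) (crv w d s)) (tang t) / (2 * sqrt (f t)))
    by (rewrite E; field; lra).
  now apply is_derive_sqrt.
Qed.

(** For angles in (0, pi) the cosine [a / r] is an increasing function of the cotangent [a / b]. The
    comparison is made by squaring, hence the split by the signs of [a] and [a']. *)
Lemma hyp_ratio_mono (a b r a' b' r' : R) :
  0 < b -> 0 < b' -> 0 < r -> 0 < r' -> r * r = a ^ 2 + b ^ 2 -> r' * r' = a' ^ 2 + b' ^ 2 ->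
  a / b < a' / b' -> a / r < a' / r'.
Proof.
  intros Hb Hb' Hr Hr' E E' H.
  assert (H1 : a * b' < a' * b).
  { apply (Rmult_lt_compat_r (b * b')) in H; [|nra].
    replace (a / b * (b * b')) with (a * b') in H by (field; lra).
    replace (a' / b' * (b * b')) with (a' * b) in H by (field; lra). exact H. }
  assert (H2 : a * r' < a' * r).
  { destruct (Rle_lt_dec 0 a) as [Ha|Ha].
    - assert (0 < a') by nra.
      apply Rsqr_incrst_0; [|nra|nra]. unfold Rsqr.
      replace (a * r' * (a * r')) with (a ^ 2 * (r' * r')) by ring.
      replace (a' * r * (a' * r)) with (a' ^ 2 * (r * r)) by ring.
      rewrite E, E'. assert (0 <= a * b') by nra. nra.
    - destruct (Rle_lt_dec 0 a') as [Ha'|Ha']; [nra|].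
      apply Ropp_lt_cancel. apply Rsqr_incrst_0; [|nra|nra]. unfold Rsqr.
      replace (- (a * r') * - (a * r')) with (a ^ 2 * (r' * r')) by ring.
      replace (- (a' * r) * - (a' * r)) with (a' ^ 2 * (r * r)) by ring.
      rewrite E, E'. assert (a' * b < 0) by nra. nra. }
  apply (Rmult_lt_reg_r (r * r')); [nra|].
  replace (a / r * (r * r')) with (a * r') by (field; lra).
  replace (a' / r' * (r * r')) with (a' * r) by (field; lra). exact H2.
Qed.

(** The ratio is the cotangent of the angle whose cosine is [inc]; unlike the cosine it has a
    derivative of evident sign. *)
Lemma is_derive_inc_ratio (w d s t : R) :
  gap w d s t <> 0 ->
  is_derive (fun u => dot (vsub (crv w d t) (crv w d u)) (tang t) / gap w d u t) s
    (rad w d s * gap w d t s / gap w d s t ^ 2).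
Proof.
  intros Hg.
  (* The normal at [s] is expanded in the frame at [t]: it is [cos (s - t)] times the normal plus
     [sin (s - t)] times the tangent. *)
  replace (rad w d s * gap w d t s) with
    (rad w d s * (- cos (s - t) * gap w d s t
      + sin (s - t) * - dot (vsub (crv w d t) (crv w d s)) (tang t))).
  2:{ rewrite <- (dot_chord_norml w d t s), <- (dot_chord_norml w d s t).
      rewrite cos_minus, sin_minus.
      generalize (crv w d t) as p, (crv w d s) as q. intros [A B] [A' B'].
      unfold dot, vsub, norml, tang; simpl. pose proof (sin2_cos2 t) as S. unfold Rsqr in S.
      transitivity (rad w d s * ((sin t * sin t + cos t * cos t)
         * ((A' - A) * cos s + (B' - B) * sin s))); [ring|rewrite S; ring]. }
  pose proof (is_derive_frame_ratio _ _ s (fst (crv w d t)) (snd (crv w d t)) (supp w d t)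
    (cos t) (sin t) _ _ (is_derive_crv1 w d s) (is_derive_crv2 w d s) Hg) as D.
  eapply (eq_ind _ (is_derive _ s) D).
  rewrite cos_minus, sin_minus. unfold gap, dot, vsub, norml, tang; simpl fst; simpl snd.
  f_equal. ring.
Qed.

(** The twist property. The cotangent increases because the radius of curvature and the gaps are
    positive as long as [s] has not come back to [t]. *)
Lemma inc_increasing (w d s s' t : R) :
  admissible w d -> t < s -> s < s' -> s' < t + 2 * PI -> inc w d s t < inc w d s' t.
Proof.
  intros H H1 H2 H3.
  assert (Hc : forall u, s <= u <= s' -> cos (t - u) < 1).
  { intros u Hu. rewrite <- cos_neg. apply cos_lt_1. lra. }
  assert (Hc' : forall u, s <= u <= s' -> cos (u - t) < 1).
  { intros u Hu. apply cos_lt_1. lra. }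
  unfold inc. rewrite !dot_unitv. fold (chord w d s t). fold (chord w d s' t).
  eapply hyp_ratio_mono; [ | | | |apply chord_sqr|apply chord_sqr|];
    [apply gap_pos|apply gap_pos|apply chord_pos|apply chord_pos|]; auto; try (apply Hc; lra).
  destruct (MVT_gen (fun u => dot (vsub (crv w d t) (crv w d u)) (tang t) / gap w d u t) s s'
    (fun u => rad w d u * gap w d t u / gap w d u t ^ 2)) as [u [Hu E]].
  - rewrite Rmin_left, Rmax_right by lra. intros u Hu. apply is_derive_inc_ratio.
    pose proof (gap_pos w d u t H (Hc u ltac:(lra))). lra.
  - rewrite Rmin_left, Rmax_right by lra. intros u Hu.
    apply derivable_continuous_pt, ex_derive_Reals_0. eexists. apply is_derive_inc_ratio.
    pose proof (gap_pos w d u t H (Hc u ltac:(lra))). lra.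
  - rewrite Rmin_left, Rmax_right in Hu by lra.
    assert (0 < rad w d u * gap w d t u / gap w d u t ^ 2).
    { apply Rdiv_lt_0_compat.
      - apply Rmult_lt_0_compat; [apply rad_pos, H|apply gap_pos; auto].
      - apply pow_lt, gap_pos; auto. }
    nra.
Qed.

(** * Lipschitz bounds and the chords of the two constant solutions *)

Lemma crv_lipschitz (w d t t' : R) :
  admissible w d -> vnorm (vsub (crv w d t) (crv w d t')) <= 4 * Rabs (t - t').
Proof.
  intros H. eapply Rle_trans; [apply vnorm_le_abs|]. cbn [vsub fst snd].
  assert (A : forall (f g : R -> R), (forall u, is_derive f u (rad w d u * g u)) ->
      (forall u, -1 <= g u <= 1) -> Rabs (f t - f t') <= 2 * Rabs (t - t')).
  { intros f g Hf Hg. destruct (MVT_gen f t' t (fun u => rad w d u * g u)) as [c [_ E]].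
    - intros u _. apply Hf.
    - intros u _. apply derivable_continuous_pt, ex_derive_Reals_0. eexists; apply Hf.
    - rewrite E, Rabs_mult. apply Rmult_le_compat_r; [apply Rabs_pos|].
      pose proof (rad_pos w d c H). specialize (Hg c). apply Rabs_le. nra. }
  assert (D1 : forall u, is_derive (fun s => fst (crv w d s)) u (rad w d u * - sin u)).
  { intros u. replace (rad w d u * - sin u) with (- rad w d u * sin u) by ring.
    apply is_derive_crv1. }
  pose proof (A _ (fun u => - sin u) D1) as A1.
  pose proof (A _ cos (is_derive_crv2 w d) COS_bound) as A2.
  assert (A1' : forall u, -1 <= - sin u <= 1) by (intros u; pose proof (SIN_bound u); lra).
  specialize (A1 A1'). cbv beta in A1, A2. lra.
Qed.

Lemma vnorm_triangle (u v : pt) : vnorm (fst u + fst v, snd u + snd v) <= vnorm u + vnorm v.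
Proof.
  pose proof (vnorm_ge0 u). pose proof (vnorm_ge0 v).
  apply Rsqr_incr_0_var; [|lra]. unfold Rsqr. rewrite vnorm_sqr.
  pose proof (vnorm_sqr u). pose proof (vnorm_sqr v).
  pose proof (dot_le_vnorm u v) as B. apply Rabs_le_between in B.
  replace (dot _ _) with (dot u u + dot v v + 2 * dot u v) by (unfold dot; simpl; ring). nra.
Qed.

(** The triangle inequality gives the bound everywhere, including at coinciding points, where the
    length of a chord is not differentiable. *)
Lemma chord_lipschitz (w d s t t' : R) :
  admissible w d -> Rabs (chord w d s t - chord w d s t') <= 4 * Rabs (t - t').
Proof.
  intros H.
  assert (A : forall u v, chord w d s u <= chord w d s v + 4 * Rabs (u - v)).
  { intros u v. pose proof (crv_lipschitz w d u v H).
    pose proof (vnorm_triangle (vsub (crv w d u) (crv w d v)) (vsub (crv w d v) (crv w d s))) as T.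
    unfold chord. replace (vsub (crv w d u) (crv w d s)) with
      (fst (vsub (crv w d u) (crv w d v)) + fst (vsub (crv w d v) (crv w d s)),
       snd (vsub (crv w d u) (crv w d v)) + snd (vsub (crv w d v) (crv w d s)))
      by (unfold vsub; simpl; f_equal; ring). lra. }
  pose proof (A t t'). pose proof (A t' t). rewrite (Rabs_minus_sym t' t) in *.
  apply Rabs_le. lra.
Qed.

Lemma vnorm_scal (k : R) (u v : pt) :
  0 <= k -> dot u u = k * k * dot v v -> vnorm u = k * vnorm v.
Proof.
  intros Hk E. unfold vnorm. rewrite E, sqrt_mult_alt by nra. now rewrite sqrt_square.
Qed.

(** At these angles [cos (w * t) = 1] and [supp'] vanishes, so the vertices form part of a regular
    polygon inscribed in the circle of radius [1 - d]. *)
Lemma chord_valley (w d : R) (j : Z) :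
  w <> 0 -> d <= 1 ->
  chord w d 0 (2 * PI * IZR j / w)
  = (1 - d) * vnorm (vsub (norml (2 * PI * IZR j / w)) (norml 0)).
Proof.
  intros Hw Hd. set (al := 2 * PI * IZR j / w).
  unfold chord. rewrite <- (Rplus_0_l al) at 1. unfold al at 1. rewrite crv_rot by trivial. fold al.
  assert (E0 : crv w d 0 = (1 - d, 0)).
  { unfold crv, supp, supp'. rewrite Rmult_0_r, cos_0, sin_0. f_equal; ring. }
  rewrite E0. apply vnorm_scal; [lra|].
  unfold dot, vsub, rot, norml; simpl. rewrite cos_0, sin_0. ring.
Qed.

(** Here [cos (w * t) = -1], and the circle has radius [1 + d]; the angular step is that of
    [chord_valley], so only the radii are to be compared. *)
Lemma chord_ridge (w d : R) (j : Z) :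
  w <> 0 -> 0 <= d ->
  chord w d (PI / w) (PI / w + 2 * PI * IZR j / w)
  = (1 + d) * vnorm (vsub (norml (2 * PI * IZR j / w)) (norml 0)).
Proof.
  intros Hw Hd. set (al := 2 * PI * IZR j / w).
  unfold chord. unfold al at 1. rewrite crv_rot by trivial. fold al.
  assert (E0 : crv w d (PI / w) = ((1 + d) * cos (PI / w), (1 + d) * sin (PI / w))).
  { unfold crv, supp, supp'. replace (w * (PI / w)) with PI by (now field).
    rewrite cos_PI, sin_PI. f_equal; ring. }
  rewrite E0. apply vnorm_scal; [lra|].
  unfold dot, vsub, rot, norml; simpl. rewrite cos_0, sin_0.
  pose proof (sin2_cos2 (PI / w)) as S. unfold Rsqr in S.
  set (X := cos (PI / w)) in *. set (Y := sin (PI / w)) in *.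
  transitivity ((1 + d) * (1 + d) * (Y * Y + X * X)
    * ((cos al - 1) * (cos al - 1) + sin al * sin al)); [ring|rewrite S; ring].
Qed.

(** * Length-maximizing chains *)

Fixpoint action (h : R -> R -> R) (y : nat -> R) (k : nat) : R :=
  match k with
  | O => 0
  | S j => action h y j + h (y j) (y (S j))
  end.

Lemma action_ext (h : R -> R -> R) (y z : nat -> R) (k : nat) :
  (forall i, (i <= k)%nat -> y i = z i) -> action h y k = action h z k.
Proof.
  induction k as [|k IH]; intros H; [easy|]. simpl.
  rewrite IH by (intros; apply H; lia). now rewrite !H by lia.
Qed.

Definition upd (y : nat -> R) (i : nat) (v : R) (j : nat) : R :=
  if Nat.eqb j i then v else y j.

Lemma upd_same (y : nat -> R) (i : nat) (v : R) : upd y i v i = v.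
Proof. unfold upd. now rewrite Nat.eqb_refl. Qed.

Lemma upd_other (y : nat -> R) (i j : nat) (v : R) : j <> i -> upd y i v j = y j.
Proof. intros H. unfold upd. now destruct (Nat.eqb_spec j i). Qed.

Lemma action_upd (h : R -> R -> R) (y : nat -> R) (i k : nat) (v : R) :
  (S i < k)%nat ->
  action h (upd y (S i) v) k - (h (y i) v + h v (y (S (S i))))
  = action h y k - (h (y i) (y (S i)) + h (y (S i)) (y (S (S i)))).
Proof.
  induction k as [|k IH]; intros Hk; [lia|]. simpl.
  destruct (Nat.eq_dec k (S i)) as [->|Hne].
  - rewrite upd_same, upd_other by lia. simpl.
    rewrite upd_same, upd_other by lia.
    rewrite (action_ext h (upd y (S i) v) y i); [ring|].
    intros j Hj. apply upd_other. lia.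
  - rewrite !upd_other by lia. specialize (IH ltac:(lia)). lra.
Qed.

(** [k] counts the free inner points. The endpoint [b] is not confined to the box and varies in the
    induction on [k]. *)
Definition maximal_chain (h : R -> R -> R) (c : R) (k : nat) (b : R) (y : nat -> R) : Prop :=
  y O = 0 /\ y (S k) = b /\ (forall i, (1 <= i <= k)%nat -> 0 <= y i <= c) /\
  forall z, z O = 0 -> z (S k) = b -> (forall i, (1 <= i <= k)%nat -> 0 <= z i <= c) ->
    action h z (S k) <= action h y (S k).

(* Dynamic programming: the optimal value is a Lipschitz function of the free
   endpoint, so only one-variable maxima are ever taken. *)
Lemma maximal_chain_exists (h : R -> R -> R) (c K : R) :
  0 <= c ->
  (forall a u v, Rabs (h a u - h a v) <= K * Rabs (u - v)) ->
  (forall a u v, Rabs (h u a - h v a) <= K * Rabs (u - v)) ->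
  forall k b, exists y, maximal_chain h c k b y.
Proof.
  intros Hc L1 L2. induction k as [|k IH]; intros b.
  - exists (upd (fun _ => 0) 1 b). split; [|split; [|split]].
    + apply upd_other. lia.
    + apply upd_same.
    + intros i Hi. lia.
    + intros z H0 H1 _. right. apply action_ext. intros i Hi.
      destruct (Nat.eq_dec i 1) as [->|Hi1]; [now rewrite upd_same|].
      rewrite upd_other by lia. now replace i with O by lia.
  - set (sol := fun x => proj1_sig (constructive_indefinite_description _ (IH x))).
    assert (Hsol : forall x, maximal_chain h c k x (sol x)).
    { intros x. unfold sol. now destruct constructive_indefinite_description. }
    set (V := fun x => action h (sol x) (S k)).
    assert (HV : forall x x', V x - V x' <= K * Rabs (x - x')).
    { intros x x'. destruct (Hsol x) as (A0 & A1 & A2 & _).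
      destruct (Hsol x') as (_ & _ & _ & B3).
      (* Moving only the last point of the optimal chain for [x] to [x'] gives a competitor that
         differs in a single chord, so [V] inherits the constant [K]. *)
      assert (B : action h (upd (sol x) (S k) x') (S k) <= V x').
      { apply B3; [rewrite upd_other by lia; exact A0|apply upd_same|].
        intros i Hi. rewrite upd_other by lia. now apply A2. }
      simpl in B. rewrite upd_same, upd_other in B by lia.
      rewrite (action_ext h _ (sol x) k) in B by (intros; apply upd_other; lia).
      unfold V at 1. simpl. rewrite A1.
      pose proof (L1 (sol x k) x x') as L. apply Rabs_le_between in L. lra. }
    assert (HK : 0 <= K).
    { pose proof (L1 0 1 0) as L. rewrite Rminus_0_r, Rabs_R1 in L.
      pose proof (Rabs_pos (h 0 1 - h 0 0)). lra. }
    destruct (continuity_ab_maj (fun x => V x + h x b) 0 c Hc) as [M [HM1 HM2]].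
    (* [V] and the last chord contribute [K] each; the added 1 covers [K = 0]. *)
    { intros x _ eps Heps. exists (eps / (2 * K + 1)).
      split; [apply Rdiv_lt_0_compat; lra|].
      intros x' [_ Hx']. simpl in *. unfold Rdist in *.
      apply (Rmult_lt_compat_r (2 * K + 1)) in Hx'; [|lra].
      unfold Rdiv in Hx'. rewrite Rmult_assoc, Rinv_l, Rmult_1_r in Hx' by lra.
      pose proof (HV x x') as A. pose proof (HV x' x) as B. rewrite (Rabs_minus_sym x x') in A.
      pose proof (L2 b x' x) as L. apply Rabs_le_between in L.
      pose proof (Rabs_pos (x' - x)).
      apply Rle_lt_trans with (2 * K * Rabs (x' - x)); [apply Rabs_le; lra|lra]. }
    destruct (Hsol M) as (A0 & A1 & A2 & A3).
    assert (E : action h (upd (sol M) (S (S k)) b) (S (S k)) = V M + h M b).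
    { change (action h (upd (sol M) (S (S k)) b) (S k)
        + h (upd (sol M) (S (S k)) b (S k)) (upd (sol M) (S (S k)) b (S (S k))) = V M + h M b).
      rewrite upd_same, upd_other, A1 by lia. f_equal.
      apply action_ext. intros i Hi. apply upd_other. lia. }
    exists (upd (sol M) (S (S k)) b). split; [|split; [|split]].
    + rewrite upd_other by lia. exact A0.
    + apply upd_same.
    + intros i Hi. rewrite upd_other by lia.
      destruct (Nat.eq_dec i (S k)) as [->|Hi1]; [now rewrite A1|]. apply A2. lia.
    + intros z Z0 Z1 Z2. rewrite E.
      change (action h z (S k) + h (z (S k)) (z (S (S k))) <= V M + h M b).
      rewrite Z1. destruct (Hsol (z (S k))) as (_ & _ & _ & B3).
      assert (B : action h z (S k) <= V (z (S k))).
      { apply B3; trivial. intros i Hi. apply Z2. lia. }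
      specialize (HM1 (z (S k)) (Z2 (S k) ltac:(lia))). simpl in HM1. lra.
Qed.

Lemma derive_at_max (f : R -> R) (c v l : R) :
  0 <= v <= c -> (forall u, 0 <= u <= c -> f u <= f v) -> is_derive f v l ->
  (v < c -> l <= 0) /\ (0 < v -> 0 <= l).
Proof.
  intros Hv Hmax Hd. apply is_derive_Reals in Hd. split; intros Hlt; apply Rnot_lt_le; intros Hl.
  - destruct (Hd l Hl) as [[dl Hdl] Hq]. simpl in Hq.
    set (s := Rmin (dl / 2) (c - v)).
    assert (Hs : 0 < s) by (apply Rmin_pos; lra).
    assert (Hs1 : s <= dl / 2) by apply Rmin_l. assert (Hs2 : s <= c - v) by apply Rmin_r.
    specialize (Hq s ltac:(lra) ltac:(rewrite Rabs_pos_eq; lra)).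
    apply Rabs_lt_between in Hq. specialize (Hmax (v + s) ltac:(lra)).
    assert (0 < (f (v + s) - f v) / s) by lra.
    assert (0 < (f (v + s) - f v) / s * s) by nra.
    replace ((f (v + s) - f v) / s * s) with (f (v + s) - f v) in * by (field; lra). lra.
  - destruct (Hd (- l) ltac:(lra)) as [[dl Hdl] Hq]. simpl in Hq.
    set (s := Rmin (dl / 2) v).
    assert (Hs : 0 < s) by (apply Rmin_pos; lra).
    assert (Hs1 : s <= dl / 2) by apply Rmin_l. assert (Hs2 : s <= v) by apply Rmin_r.
    specialize (Hq (- s) ltac:(lra) ltac:(rewrite Rabs_left1; lra)).
    apply Rabs_lt_between in Hq. specialize (Hmax (v + - s) ltac:(lra)).
    assert ((f (v + - s) - f v) / - s < 0) by lra.
    assert (0 < (f (v + - s) - f v) / - s * - s) by nra.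
    replace ((f (v + - s) - f v) / - s * - s) with (f (v + - s) - f v) in * by (field; lra). lra.
Qed.

(** Descend from [i] to 1, then climb from 0: a contact with a wall reaches every index, the pinned
    ends included. *)
Lemma nat_propagation (N : nat) (P : nat -> Prop) :
  (forall i, (S i < N)%nat -> P (S i) -> P i /\ P (S (S i))) ->
  forall i, (0 < i < N)%nat -> P i -> forall j, (j <= N)%nat -> P j.
Proof.
  intros H i Hi Pi.
  assert (P1 : P 1%nat).
  { destruct i as [|i]; [lia|]. induction i as [|i IH]; [exact Pi|].
    apply IH; [lia|]. now apply (H (S i)). }
  induction j as [|j IH]; intros Hj; [apply (H O); [lia|exact P1]|].
  destruct j as [|j]; [exact P1|]. apply (H j); [lia|]. apply IH. lia.
Qed.

Lemma action_zero (h : R -> R -> R) (y : nat -> R) (k : nat) :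
  (forall i, (i <= k)%nat -> y i = 0) -> action h y k = INR k * h 0 0.
Proof.
  induction k as [|k IH]; intros H; [simpl; ring|].
  change (action h y (S k)) with (action h y k + h (y k) (y (S k))).
  rewrite IH by (intros; apply H; lia). rewrite !H, S_INR by lia. ring.
Qed.

(** The competitor against the zero chain: jump to [c] at once and stay. The jump back to 0 is added
    where it is used. *)
Lemma action_plateau (h : R -> R -> R) (c : R) (k : nat) :
  action h (fun i => match i with O => 0 | _ => c end) (S k) = h 0 c + INR k * h c c.
Proof.
  induction k as [|k IH]; [simpl; ring|].
  set (z := fun i : nat => _) in *.
  change (action h z (S (S k))) with (action h z (S k) + h c c). rewrite IH, S_INR. ring.
Qed.

(* [E a v b] stands for the derivative at [v] of the action of the chain
   [a, v, b], up to a positive factor. Both constant chains [0] and [c] are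
   critical and repel the neighbours inwards, while [c] is strictly better. *)
Lemma interior_chain (h : R -> R -> R) (E : R -> R -> R -> R) (r : R -> R) (c K : R) :
  0 < c ->
  (forall a u v, Rabs (h a u - h a v) <= K * Rabs (u - v)) ->
  (forall a u v, Rabs (h u a - h v a) <= K * Rabs (u - v)) ->
  (forall v, 0 < r v) ->
  (forall a v b, 0 <= a <= c -> 0 <= v <= c -> 0 <= b <= c ->
    is_derive (fun u => h a u + h u b) v (r v * E a v b)) ->
  (forall a b, 0 <= a <= c -> 0 <= b <= c -> E a 0 b <= 0 -> a = 0 /\ b = 0) ->
  (forall a b, 0 <= a <= c -> 0 <= b <= c -> 0 <= E a c b -> a = c /\ b = c) ->
  0 <= h 0 c -> 0 <= h c 0 -> h 0 0 < h c c ->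
  exists N0 : nat, forall N, (N0 <= N)%nat -> exists y : nat -> R,
    y O = 0 /\ y N = 0 /\
    forall i, (S i < N)%nat -> 0 < y (S i) < c /\ E (y i) (y (S i)) (y (S (S i))) = 0.
Proof.
  intros Hc L1 L2 Hr HD HE0 HEc Ha Hb Hlt.
  (* With [k + 2] steps the zero chain has action [(k + 2) * h 0 0], while the plateau has at least
     [k * h c c], its two jumps being nonnegative. *)
  destruct (INR_unbounded (2 * h 0 0 / (h c c - h 0 0))) as [n0 Hn0].
  apply (Rmult_lt_compat_r (h c c - h 0 0)) in Hn0; [|lra].
  unfold Rdiv in Hn0. rewrite Rmult_assoc, Rinv_l, Rmult_1_r in Hn0 by lra.
  exists (S (S n0)). intros N HN.
  destruct N as [|[|k]]; [lia|lia|].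
  assert (Hk : INR n0 <= INR k) by (apply le_INR; lia).
  destruct (maximal_chain_exists h c K ltac:(lra) L1 L2 (S k) 0) as (y & Y0 & Y1 & Y2 & Y3).
  exists y. split; [exact Y0|]. split; [exact Y1|].
  assert (Yc : forall i, (i <= S (S k))%nat -> 0 <= y i <= c).
  { intros i Hi. destruct (Nat.eq_dec i 0) as [->|]; [rewrite Y0; lra|].
    destruct (Nat.eq_dec i (S (S k))) as [->|]; [rewrite Y1; lra|]. apply Y2. lia. }
  assert (Hcrit : forall i, (S i < S (S k))%nat ->
    (y (S i) < c -> E (y i) (y (S i)) (y (S (S i))) <= 0) /\
    (0 < y (S i) -> 0 <= E (y i) (y (S i)) (y (S (S i))))).
  { intros i Hi.
    destruct (derive_at_max (fun u => h (y i) u + h u (y (S (S i)))) c (y (S i))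
      (r (y (S i)) * E (y i) (y (S i)) (y (S (S i))))) as [D1 D2].
    - apply Yc. lia.
    - intros u Hu.
      assert (B : action h (upd y (S i) u) (S (S k)) <= action h y (S (S k))).
      { apply Y3; [rewrite upd_other by lia; exact Y0|rewrite upd_other by lia; exact Y1|].
        intros j Hj. destruct (Nat.eq_dec j (S i)) as [->|]; [now rewrite upd_same|].
        rewrite upd_other by trivial. now apply Y2. }
      pose proof (action_upd h y i (S (S k)) u Hi). lra.
    - apply HD; apply Yc; lia.
    - pose proof (Hr (y (S i))). split; intros; [specialize (D1 H0)|specialize (D2 H0)]; nra. }
  (* A contact with 0 would make the whole chain zero, which the plateau beats. *)
  assert (Hpos : forall i, (0 < i < S (S k))%nat -> y i <> 0).
  { intros i Hi Hz.
    assert (Z : forall j, (j <= S (S k))%nat -> y j = 0).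
    { apply (nat_propagation (S (S k)) (fun j => y j = 0)) with (i := i); trivial.
      intros j Hj Ej. apply HE0; [apply Yc; lia|apply Yc; lia|].
      destruct (Hcrit j Hj) as [D1 _]. rewrite Ej in D1. apply D1. lra. }
    pose proof (action_zero h y (S (S k)) Z) as A0.
    set (z := upd (fun i => match i with O => 0 | _ => c end) (S (S k)) 0).
    assert (B : action h z (S (S k)) <= action h y (S (S k))).
    { apply Y3.
      - reflexivity.
      - apply upd_same.
      - intros j Hj. unfold z. rewrite upd_other by lia. destruct j; lra. }
    change (action h z (S (S k))) with (action h z (S k) + h (z (S k)) (z (S (S k)))) in B.
    unfold z in B. rewrite upd_same, upd_other in B by lia.
    rewrite (action_ext h _ (fun i => match i with O => 0 | _ => c end) (S k)) in B
      by (intros; apply upd_other; lia).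
    rewrite action_plateau, A0, !S_INR in B. nra. }
  (* A contact with [c] would spread to the end pinned at 0. *)
  assert (Hltc : forall i, (0 < i < S (S k))%nat -> y i <> c).
  { intros i Hi Hz.
    assert (Z : y O = c).
    { apply (nat_propagation (S (S k)) (fun j => y j = c)) with (i := i); trivial; [|lia].
      intros j Hj Ej. apply HEc; [apply Yc; lia|apply Yc; lia|].
      destruct (Hcrit j Hj) as [_ D2]. rewrite Ej in D2. apply D2. lra. }
    lra. }
  intros i Hi. pose proof (Yc (S i) ltac:(lia)). pose proof (Hpos (S i) ltac:(lia)).
  pose proof (Hltc (S i) ltac:(lia)). destruct (Hcrit i Hi) as [D1 D2].
  assert (0 < y (S i) < c) by lra. split; [trivial|]. apply Rle_antisym; [apply D1|apply D2]; lra.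
Qed.

(** The chord between consecutive points, turned back by a multiple of the symmetry angle, is
    [chord w d (a - al) b] whatever the index. The sum of the two incidences at a point is the
    derivative of the length up to the factor [rad]. *)
Lemma billiard_chain (w d : R) (m : Z) :
  admissible w d -> (1 <= m)%Z -> IZR m <= w - 1 ->
  exists N0 : nat, forall N, (N0 <= N)%nat -> exists y : nat -> R,
    y O = 0 /\ y N = 0 /\
    forall i, (S i < N)%nat -> 0 < y (S i) < PI / w /\
      inc w d (y i - 2 * PI * IZR m / w) (y (S i))
      + inc w d (y (S (S i)) + 2 * PI * IZR m / w) (y (S i)) = 0.
Proof.
  intros H Hm1 Hm2. pose proof (admissible_w_ge1 w d H) as Hw1.
  pose proof (admissible_d_lt1 w d H) as Hd1. pose proof PI_RGT_0 as HPI.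
  assert (Hd0 : 0 < d) by apply H.
  assert (Hw : w <> 0) by lra.
  apply IZR_le in Hm1.
  set (al := 2 * PI * IZR m / w). set (c := PI / w).
  assert (Hc : 0 < c) by (apply Rdiv_lt_0_compat; lra).
  assert (Ew : w * c = PI) by (unfold c; field; lra).
  assert (Eal : al = 2 * c * IZR m) by (unfold al, c; field; lra).
  (* Corrections in the box differ by at most [c], so the margin [2 * c] on both sides keeps
     neighbouring points distinct modulo [2 * PI]. *)
  assert (Hal1 : 2 * c <= al) by nra.
  assert (Hal2 : al <= 2 * PI - 2 * c) by nra.
  apply (interior_chain (fun a b => chord w d (a - al) b)
    (fun a v b => inc w d (a - al) v + inc w d (b + al) v) (rad w d) c 4 Hc).
  - intros a u v. now apply chord_lipschitz.
  - intros a u v. rewrite (chord_sym w d _ a), (chord_sym w d _ a).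
    replace (u - v) with ((u - al) - (v - al)) by ring. now apply chord_lipschitz.
  - intros v. now apply rad_pos.
  - intros a v b Ha Hv Hb. rewrite Rmult_plus_distr_l.
    apply (is_derive_plus (chord w d (a - al))).
    + apply is_derive_chord; trivial. apply cos_lt_1. lra.
    + apply is_derive_ext with (chord w d (b + al)).
      * assert (X : forall u : R, chord w d (b + al) u = chord w d (u - al) b).
        { intros u. rewrite (chord_sym w d (u - al) b).
          rewrite <- (chord_rot w d b (u - al) m Hw). fold al. f_equal. ring. }
        exact X.
      * apply is_derive_chord; trivial. rewrite <- cos_neg. apply cos_lt_1. lra.
  - intros a b Ha Hb HE.
    assert (E0 : inc w d (0 - al) 0 = - inc w d al 0).
    { rewrite <- (inc_refl w d al 0), Ropp_0. f_equal; ring. }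
    (* The preceding point lies behind the base point; a full turn moves it into the interval where
       the twist property is stated. *)
    assert (A1 : 0 < a -> inc w d (0 - al) 0 < inc w d (a - al) 0).
    { intros. rewrite <- (inc_2PI w d (0 - al) 0 1 H), <- (inc_2PI w d (a - al) 0 1 H).
      apply inc_increasing; trivial; lra. }
    assert (A2 : 0 < b -> inc w d al 0 < inc w d (b + al) 0).
    { intros. apply inc_increasing; trivial; lra. }
    destruct (Rle_lt_or_eq_dec 0 a (proj1 Ha)) as [Pa| <-];
      destruct (Rle_lt_or_eq_dec 0 b (proj1 Hb)) as [Pb| <-]; try rewrite Rplus_0_l in HE;
      try specialize (A1 Pa); try specialize (A2 Pb); lra.
  - intros a b Ha Hb HE.
    (* The mirror through the angle [c] is the reflection in the first axis followed by the rotation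
       by [2 * c], one symmetry step. *)
    assert (E0 : inc w d (c - al) c = - inc w d (c + al) c).
    { replace (inc w d (c + al) c) with (inc w d (- (c - al)) (- c)); [rewrite inc_refl; ring|].
      rewrite <- (inc_rot w d (- (c - al)) (- c) 1 Hw).
      replace (2 * PI * 1 / w) with (2 * c) by (unfold c; field; lra). f_equal; ring. }
    assert (A1 : a < c -> inc w d (a - al) c < inc w d (c - al) c).
    { intros. rewrite <- (inc_2PI w d (a - al) c 1 H), <- (inc_2PI w d (c - al) c 1 H).
      apply inc_increasing; trivial; lra. }
    assert (A2 : b < c -> inc w d (b + al) c < inc w d (c + al) c).
    { intros. apply inc_increasing; trivial; lra. }
    destruct (Rle_lt_or_eq_dec a c (proj2 Ha)) as [Pa| ->];
      destruct (Rle_lt_or_eq_dec b c (proj2 Hb)) as [Pb| ->];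
      try specialize (A1 Pa); try specialize (A2 Pb); lra.
  - apply vnorm_ge0.
  - apply vnorm_ge0.
  - rewrite (chord_sym w d (0 - al)), (chord_sym w d (c - al)).
    rewrite <- (chord_rot w d 0 (0 - al) m Hw), <- (chord_rot w d c (c - al) m Hw). fold al.
    replace (0 - al + al) with 0 by ring. replace (c - al + al) with c by ring.
    rewrite (chord_sym w d _ 0), (chord_sym w d _ c), Rplus_0_l.
    unfold c, al. rewrite chord_valley, chord_ridge by lra. fold al.
    assert (0 < vnorm (vsub (norml al) (norml 0))).
    { apply vnorm_lt_pos. unfold vsub, norml; simpl. rewrite cos_0. intros EE.
      apply (f_equal fst) in EE. simpl in EE. pose proof (cos_lt_1 al). lra. }
    nra.
Qed.

(** * Odd periodic orbits *)

(** Periodic with period [2 * N]. It is odd when [y] vanishes at 0 and at [N], the two fixed indices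
    of [i -> - i] modulo the period. *)
Definition odd_ext (y : nat -> R) (N : nat) (i : Z) : R :=
  let r := (i mod (2 * Z.of_nat N))%Z in
  if (r <=? Z.of_nat N)%Z then y (Z.to_nat r) else - y (Z.to_nat (2 * Z.of_nat N - r)).

Lemma odd_ext_period (y : nat -> R) (N : nat) (i k : Z) :
  odd_ext y N (i + k * (2 * Z.of_nat N)) = odd_ext y N i.
Proof.
  unfold odd_ext. destruct N as [|N]; [now rewrite Z.mul_0_r, Z.mul_0_r, Z.add_0_r|].
  now rewrite Z_mod_plus_full.
Qed.

Lemma odd_ext_nat (y : nat -> R) (N i : nat) :
  (0 < N)%nat -> (i <= N)%nat -> odd_ext y N (Z.of_nat i) = y i.
Proof.
  intros HN Hi. unfold odd_ext. rewrite Z.mod_small by lia.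
  destruct (Z.leb_spec (Z.of_nat i) (Z.of_nat N)); [|lia]. now rewrite Nat2Z.id.
Qed.

Lemma odd_ext_opp (y : nat -> R) (N : nat) (i : Z) :
  (0 < N)%nat -> y O = 0 -> y N = 0 -> odd_ext y N (- i) = - odd_ext y N i.
Proof.
  intros HN Y0 YN. unfold odd_ext.
  pose proof (Z.mod_pos_bound i (2 * Z.of_nat N) ltac:(lia)) as Hr.
  destruct (Z.eq_dec (i mod (2 * Z.of_nat N)) 0) as [E|E].
  - rewrite (Z_mod_zero_opp_full _ _ E), E.
    destruct (Z.leb_spec 0 (Z.of_nat N)); [|lia]. simpl. rewrite Y0. ring.
  - rewrite (Z_mod_nz_opp_full _ _ E).
    set (r := (i mod (2 * Z.of_nat N))%Z) in *.
    destruct (Z.leb_spec (2 * Z.of_nat N - r) (Z.of_nat N)), (Z.leb_spec r (Z.of_nat N)).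
    + replace r with (Z.of_nat N) by lia.
      replace (2 * Z.of_nat N - Z.of_nat N)%Z with (Z.of_nat N) by lia.
      rewrite Nat2Z.id, YN. ring.
    + ring.
    + do 2 f_equal. lia.
    + lia.
Qed.

Lemma odd_ext_bound (y : nat -> R) (N : nat) (c : R) (i : Z) :
  (0 < N)%nat -> (forall j, (j <= N)%nat -> 0 <= y j < c) -> - c < odd_ext y N i < c.
Proof.
  intros HN Hy. unfold odd_ext.
  pose proof (Z.mod_pos_bound i (2 * Z.of_nat N) ltac:(lia)) as Hr.
  set (r := (i mod (2 * Z.of_nat N))%Z) in *.
  destruct (Z.leb_spec r (Z.of_nat N)).
  - pose proof (Hy (Z.to_nat r) ltac:(lia)). lra.
  - pose proof (Hy (Z.to_nat (2 * Z.of_nat N - r)) ltac:(lia)). lra.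
Qed.

(** Reflection law at the point of angle [e i + i * al], written in the frame turned back by
    [i * al], where the explicit dependence on [i] disappears. *)
Definition equilibrium (w d al : R) (e : Z -> R) (i : Z) : Prop :=
  inc w d (e (i - 1)%Z - al) (e i) + inc w d (e (i + 1)%Z + al) (e i) = 0.

Lemma equilibrium_opp (w d al : R) (e : Z -> R) (i : Z) :
  (forall j, e (- j)%Z = - e j) -> equilibrium w d al e i -> equilibrium w d al e (- i).
Proof.
  unfold equilibrium. intros He H.
  replace (- i - 1)%Z with (- (i + 1))%Z by lia.
  replace (- i + 1)%Z with (- (i - 1))%Z by lia.
  rewrite !He.
  replace (- e (i + 1)%Z - al) with (- (e (i + 1)%Z + al)) by ring.
  replace (- e (i - 1)%Z + al) with (- (e (i - 1)%Z - al)) by ring.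
  rewrite !inc_refl. lra.
Qed.

(** The two chords at this point are mirror images in the symmetry axis through it. This supplies
    the law at indices 0 and [N], where the maximizer was pinned. *)
Lemma equilibrium_centre (w d al : R) (e : Z -> R) (i : Z) :
  e i = 0 -> e (i - 1)%Z = - e (i + 1)%Z -> equilibrium w d al e i.
Proof.
  unfold equilibrium. intros E0 E1. rewrite E0, E1.
  replace (- e (i + 1)%Z - al) with (- (e (i + 1)%Z + al)) by ring.
  rewrite <- Ropp_0 at 1. rewrite inc_refl. ring.
Qed.

Lemma equilibrium_odd_ext (w d al : R) (y : nat -> R) (N : nat) :
  (0 < N)%nat -> y O = 0 -> y N = 0 ->
  (forall i, (S i < N)%nat ->
    inc w d (y i - al) (y (S i)) + inc w d (y (S (S i)) + al) (y (S i)) = 0) ->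
  forall i, equilibrium w d al (odd_ext y N) i.
Proof.
  intros HN Y0 YN Hy.
  set (e := odd_ext y N).
  assert (Hodd : forall j, e (- j)%Z = - e j) by (intros; now apply odd_ext_opp).
  assert (Hper : forall j k, e (j + k * (2 * Z.of_nat N))%Z = e j)
    by (intros; apply odd_ext_period).
  assert (Hnat : forall j, (j <= N)%nat -> e (Z.of_nat j) = y j)
    by (intros; now apply odd_ext_nat).
  assert (P1 : forall i k, equilibrium w d al e i ->
    equilibrium w d al e (i + k * (2 * Z.of_nat N))).
  { unfold equilibrium. intros i k H.
    replace (i + k * (2 * Z.of_nat N) - 1)%Z with (i - 1 + k * (2 * Z.of_nat N))%Z by lia.
    replace (i + k * (2 * Z.of_nat N) + 1)%Z with (i + 1 + k * (2 * Z.of_nat N))%Z by lia.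
    now rewrite !Hper. }
  assert (P2 : forall i, (0 <= i <= Z.of_nat N)%Z -> equilibrium w d al e i).
  { intros i Hi.
    destruct (Z.eq_dec i 0) as [->|Hi0]; [|destruct (Z.eq_dec i (Z.of_nat N)) as [->|HiN]].
    - apply equilibrium_centre.
      + change 0%Z with (Z.of_nat 0). rewrite Hnat; [trivial|lia].
      + simpl. change (-1)%Z with (- (1))%Z. apply Hodd.
    - apply equilibrium_centre.
      + rewrite Hnat; [trivial|lia].
      + rewrite <- (Hper (Z.of_nat N - 1)%Z (-1)%Z), <- Hodd. f_equal. lia.
    - unfold equilibrium.
      destruct (Z.to_nat i) as [|j] eqn:Ej; [lia|].
      replace (i - 1)%Z with (Z.of_nat j) by lia.
      replace (i + 1)%Z with (Z.of_nat (S (S j))) by lia.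
      replace i with (Z.of_nat (S j)) by lia.
      rewrite !Hnat by lia. apply Hy. lia. }
  intros i.
  replace i with (i mod (2 * Z.of_nat N) + (i / (2 * Z.of_nat N)) * (2 * Z.of_nat N))%Z
    by (pose proof (Z.div_mod i (2 * Z.of_nat N)); lia).
  apply P1.
  pose proof (Z.mod_pos_bound i (2 * Z.of_nat N) ltac:(lia)) as Hr.
  set (r := (i mod (2 * Z.of_nat N))%Z) in *.
  destruct (Z_le_gt_dec r (Z.of_nat N)); [apply P2; lia|].
  replace r with (- (2 * Z.of_nat N - r) + 1 * (2 * Z.of_nat N))%Z by lia.
  apply P1, equilibrium_opp; trivial. apply P2. lia.
Qed.

(** * From equilibria to billiard orbits *)

Lemma no_Z_multiple_2PI (x : R) (k : Z) : 0 < x < 2 * PI -> x <> 2 * PI * IZR k.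
Proof.
  intros Hx E. pose proof PI_RGT_0.
  assert (0 < k < 1)%Z; [|lia]. split; apply lt_IZR.
  - apply (Rmult_lt_reg_l (2 * PI)); lra.
  - apply (Rmult_lt_reg_l (2 * PI)); lra.
Qed.

Definition angle (al : R) (e : Z -> R) (i : Z) : R := e i + IZR i * al.

Lemma tang_2PI (t : R) (k : Z) : tang (t + 2 * PI * IZR k) = tang t.
Proof. unfold tang. now rewrite sin_2PI_Z, cos_2PI_Z. Qed.

Lemma rad_2PI (w d t : R) (k : Z) :
  admissible w d -> rad w d (t + 2 * PI * IZR k) = rad w d t.
Proof.
  intros H. pose proof (supp_2PI w d t k H) as E. unfold supp in E.
  destruct H as (Hd & _). unfold rad.
  assert (cos (w * (t + 2 * PI * IZR k)) = cos (w * t)) as -> by nra. ring.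
Qed.

Lemma dgamma_crv (w d t : R) :
  dgamma (fun x => crv w d (2 * PI * x)) t
  = (2 * PI * rad w d (2 * PI * t) * fst (tang (2 * PI * t)),
     2 * PI * rad w d (2 * PI * t) * snd (tang (2 * PI * t))).
Proof.
  assert (L : is_derive (fun x => 2 * PI * x) t (2 * PI)) by (auto_derive; [easy|ring]).
  unfold dgamma. f_equal; apply is_derive_unique.
  - pose proof (is_derive_comp _ _ t _ _ (is_derive_crv1 w d (2 * PI * t)) L) as D.
    eapply (eq_ind _ (is_derive _ t) D). unfold scal; simpl; unfold mult; simpl. ring.
  - pose proof (is_derive_comp _ _ t _ _ (is_derive_crv2 w d (2 * PI * t)) L) as D.
    eapply (eq_ind _ (is_derive _ t) D). unfold scal; simpl; unfold mult; simpl. ring.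
Qed.

Lemma crv_simple_closed (w d : R) :
  admissible w d -> simple_closed_param (fun x => crv w d (2 * PI * x)).
Proof.
  intros H. pose proof PI_RGT_0 as HPI.
  assert (D1 : forall x, ex_derive (fun s => fst (crv w d (2 * PI * s))) x).
  { intros x. apply (ex_derive_comp (fun s => fst (crv w d s))).
    - eexists. apply is_derive_crv1.
    - now auto_derive. }
  assert (D2 : forall x, ex_derive (fun s => snd (crv w d (2 * PI * s))) x).
  { intros x. apply (ex_derive_comp (fun s => snd (crv w d s))).
    - eexists. apply is_derive_crv2.
    - now auto_derive. }
  split; [|split; [|split]].
  - intros x. rewrite <- (crv_2PI w d (2 * PI * x) 1 H). f_equal. ring.
  - intros x. split.
    + exact (ex_derive_continuous _ _ (D1 x)).
    + exact (ex_derive_continuous _ _ (D2 x)).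
  - intros s t Hs Ht E. destruct (crv_inj w d _ _ H E) as [k Hk].
    assert (Ek : t = s + IZR k) by nra.
    assert (k = 0)%Z.
    { assert (-1 < k < 1)%Z by (split; apply lt_IZR; lra). lia. }
    subst k. lra.
  - intros x. split; [apply D1|]. split; [apply D2|].
    rewrite dgamma_crv. intros E.
    pose proof (rad_pos w d (2 * PI * x) H) as [Hr _].
    apply (f_equal (fun p => fst p * fst p + snd p * snd p)) in E. simpl in E.
    pose proof (sin2_cos2 (2 * PI * x)) as S. unfold Rsqr in S.
    set (q := 2 * PI * rad w d (2 * PI * x)) in *.
    assert (0 < q) by (unfold q; apply Rmult_lt_0_compat; lra).
    set (a := sin _) in *. set (b := cos _) in *.
    assert (q * q * (a * a + b * b) = 0) by lra.
    rewrite S in *. nra.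
Qed.

Lemma billiard_orbit_of_equilibrium (w d : R) (m : Z) (e : Z -> R) :
  admissible w d ->
  (forall i, equilibrium w d (2 * PI * IZR m / w) e i) ->
  (forall i, 0 < e (i + 1)%Z - e i + 2 * PI * IZR m / w < 2 * PI) ->
  billiard_orbit (fun x => crv w d (2 * PI * x))
    (fun i => crv w d (angle (2 * PI * IZR m / w) e i)).
Proof.
  intros H Heq Hstep i. pose proof PI_RGT_0 as HPI.
  pose proof (admissible_w_ge1 w d H) as Hw1. assert (Hw : w <> 0) by lra.
  set (al := 2 * PI * IZR m / w) in *.
  (* Since [i * al] is [i * m] symmetry steps, the rotation by it is a symmetry of the curve. *)
  assert (Hinc : forall j, inc w d (angle al e (i + j)) (angle al e i)
      = inc w d (e (i + j)%Z + IZR j * al) (e i)).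
  { intros j. rewrite <- (inc_rot w d (e (i + j)%Z + IZR j * al) (e i) (i * m) Hw).
    unfold angle. rewrite plus_IZR, mult_IZR. f_equal; unfold al; field; lra. }
  split; [|split].
  - exists (angle al e i / (2 * PI)). f_equal. field. lra.
  - intros E. destruct (crv_inj w d _ _ H E) as [k Hk].
    unfold angle in Hk. rewrite plus_IZR in Hk. specialize (Hstep i).
    apply (no_Z_multiple_2PI _ k Hstep). lra.
  - intros t Et. symmetry in Et. destruct (crv_inj w d _ _ H Et) as [k Hk].
    rewrite dgamma_crv, Hk, tang_2PI, (rad_2PI w d _ k H).
    set (th := angle al e i) in *. set (q := 2 * PI * rad w d th).
    pose proof (Heq i) as Hi. unfold equilibrium in Hi.
    pose proof (Hinc (-1)%Z) as I1. pose proof (Hinc 1%Z) as I2.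
    replace (i + -1)%Z with (i - 1)%Z in I1 by lia.
    replace (e (i - 1)%Z + -1 * al) with (e (i - 1)%Z - al) in I1 by ring.
    replace (e (i + 1)%Z + 1 * al) with (e (i + 1)%Z + al) in I2 by ring.
    rewrite <- I1, <- I2 in Hi. unfold inc in Hi. rewrite !dot_unitv in *.
    fold th in Hi.
    replace (vnorm (vsub (crv w d th) (crv w d (angle al e (i + 1)))))
      with (vnorm (vsub (crv w d (angle al e (i + 1))) (crv w d th))) in Hi
      by (unfold vnorm; f_equal; unfold dot, vsub; simpl; ring).
    assert (Dq : forall u, dot u (q * fst (tang th), q * snd (tang th)) = q * dot u (tang th))
      by (intros; unfold dot; simpl; ring).
    rewrite !Dq. unfold Rdiv in *. rewrite !Rmult_assoc. f_equal.
    rewrite !dot_vsub in *. lra.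
Qed.

Lemma nonBirkhoff_odd_orbit (w d : R) (m n : Z) (y : nat -> R) (N : nat) :
  admissible w d -> w = IZR n -> (1 <= m)%Z -> (m <= n - 1)%Z -> (n < Z.of_nat N)%Z ->
  y O = 0 -> y N = 0 ->
  (forall i, (S i < N)%nat -> 0 < y (S i) < PI / w /\
      inc w d (y i - 2 * PI * IZR m / w) (y (S i))
      + inc w d (y (S (S i)) + 2 * PI * IZR m / w) (y (S i)) = 0) ->
  nonBirkhoff_periodic_orbit (fun x => crv w d (2 * PI * x)) (IZR m / IZR n)
    (fun i => crv w d (angle (2 * PI * IZR m / w) (odd_ext y N) i)).
Proof.
  intros H Hwn Hm1 Hm2 HN Y0 YN Hy. pose proof PI_RGT_0 as HPI.
  pose proof (admissible_w_ge1 w d H) as Hw1. assert (Hw : w <> 0) by lra.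
  set (al := 2 * PI * IZR m / w) in *. set (e := odd_ext y N).
  set (c := PI / w) in *.
  assert (Hc : 0 < c) by (apply Rdiv_lt_0_compat; lra).
  assert (Ew : w * c = PI) by (unfold c; field; lra).
  assert (Eal : al = 2 * c * IZR m) by (unfold al, c; field; lra).
  assert (Hm1' := IZR_le _ _ Hm1). assert (Hm2' := IZR_le _ _ Hm2).
  rewrite minus_IZR, <- Hwn in Hm2'.
  assert (Hal1 : 2 * c <= al) by nra.
  assert (Hal2 : al <= 2 * PI - 2 * c) by nra.
  assert (HN0 : (0 < N)%nat) by lia.
  assert (Yb : forall j, (j <= N)%nat -> 0 <= y j < c).
  { intros j Hj. destruct j as [|j]; [rewrite Y0; lra|].
    destruct (Nat.eq_dec (S j) N) as [->|Hne]; [rewrite YN; lra|].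
    destruct (Hy j ltac:(lia)). lra. }
  assert (Eb : forall i, - c < e i < c) by (intros; now apply odd_ext_bound).
  assert (Eper : forall i k, e (i + k * (2 * Z.of_nat N))%Z = e i)
    by (intros; apply odd_ext_period).
  assert (Hstep : forall i, 0 < e (i + 1)%Z - e i + al < 2 * PI).
  { intros i. pose proof (Eb i). pose proof (Eb (i + 1)%Z). lra. }
  assert (Ealn : IZR n * al = 2 * PI * IZR m) by (rewrite <- Hwn; unfold al; field; lra).
  split; [|split].
  - apply billiard_orbit_of_equilibrium; trivial.
    apply equilibrium_odd_ext; trivial. intros i Hi. apply Hy, Hi.
  (* The corrections repeat after [2 * N] indices, and [n] steps of size [al] make exactly [m]
     turns. *)
  - exists (n * (2 * Z.of_nat N))%Z. split; [nia|]. intros i.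
    unfold angle. rewrite Eper, plus_IZR, (Z.mul_comm n), mult_IZR.
    replace (e i + (IZR i + IZR (2 * Z.of_nat N) * IZR n) * al)
      with (e i + IZR i * al + 2 * PI * IZR (2 * Z.of_nat N * m)).
    + now apply crv_2PI.
    + rewrite (mult_IZR (2 * Z.of_nat N) m).
      transitivity (e i + IZR i * al + IZR (2 * Z.of_nat N) * (IZR n * al));
        [rewrite Ealn|]; ring.
  - exists (fun i => angle al e i / (2 * PI)). split; [|split].
    + intros i. split; [f_equal; field; lra|].
      replace (angle al e (i + 1) / (2 * PI) - angle al e i / (2 * PI))
        with ((e (i + 1)%Z - e i + al) / (2 * PI))
        by (unfold angle; rewrite plus_IZR; field; lra).
      specialize (Hstep i). split.
      * apply Rdiv_lt_0_compat; lra.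
      * apply (Rmult_lt_reg_r (2 * PI)); [lra|].
        unfold Rdiv. rewrite Rmult_assoc, Rinv_l by lra. lra.
    + apply is_lim_seq_spec. intros eps.
      destruct (INR_unbounded (/ eps)) as [k0 Hk0]. exists k0. intros k Hk.
      pose proof (cond_pos eps) as He. pose proof (Rinv_0_lt_compat _ He) as Hie.
      apply le_INR in Hk.
      replace (angle al e (Z.of_nat k) / (2 * PI) / INR k - IZR m / IZR n)
        with (e (Z.of_nat k) / (2 * PI) / INR k).
      2:{ unfold angle. rewrite <- INR_IZR_INZ, <- Hwn. unfold al. field. lra. }
      assert (Hcp : c <= PI) by nra.
      specialize (Eb (Z.of_nat k)). unfold Rdiv. rewrite Rabs_mult.
      rewrite (Rabs_pos_eq (/ INR k)) by (left; apply Rinv_0_lt_compat; lra).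
      assert (A : Rabs (e (Z.of_nat k) * / (2 * PI)) <= 1).
      { rewrite Rabs_mult, (Rabs_pos_eq (/ (2 * PI))) by (left; apply Rinv_0_lt_compat; lra).
        apply (Rmult_le_reg_r (2 * PI)); [lra|]. rewrite Rmult_assoc, Rinv_l by lra.
        rewrite Rmult_1_r, Rmult_1_l. apply Rabs_le. lra. }
      assert (B : / INR k < eps).
      { rewrite <- (Rinv_inv eps). apply Rinv_lt_contravar; [nra|lra]. }
      pose proof (Rinv_0_lt_compat (INR k) ltac:(lra)). nra.
    + intros HB.
      assert (En0 : e n = y (Z.to_nat n)).
      { rewrite <- (Z2Nat.id n) at 1 by lia. apply odd_ext_nat; lia. }
      assert (En : 0 < e n).
      { rewrite En0. destruct (Z.to_nat n) as [|j] eqn:Ej; [lia|]. now apply Hy; lia. }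
      assert (E0 : e 0%Z = 0).
      { change 0%Z with (Z.of_nat 0). unfold e. now rewrite odd_ext_nat by lia. }
      assert (Ex : forall i j, angle al e i / (2 * PI) <= angle al e (j + n) / (2 * PI) + IZR (- m)
        <-> e i + IZR i * al <= e (j + n)%Z + IZR j * al).
      { intros i j. unfold angle.
        replace ((e (j + n)%Z + IZR (j + n) * al) / (2 * PI) + IZR (- m))
          with ((e (j + n)%Z + IZR j * al) / (2 * PI)).
        - split; intros L.
          + apply (Rmult_le_reg_r (/ (2 * PI))); [apply Rinv_0_lt_compat; lra|exact L].
          + apply Rmult_le_compat_r; [left; apply Rinv_0_lt_compat; lra|exact L].
        - rewrite plus_IZR, opp_IZR, Rmult_plus_distr_r, Ealn. field. lra. }
      (* The comparison of indices 0 and [n] with shift [- m] amounts to [e 0 <= e n], which holds;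
         the Birkhoff property carries it to every index. *)
      assert (Hmono : forall i, e i <= e (i + n)%Z).
      { intros i. pose proof (HB 0%Z (0 + n)%Z (- m)%Z i) as Hi. cbv beta in Hi.
        rewrite Ex in Hi. specialize (Hi ltac:(rewrite Z.add_0_l, E0; lra)).
        rewrite Z.add_0_l in Hi. replace (0 + n + i)%Z with (i + n)%Z in Hi by lia.
        apply Ex in Hi. lra. }
      assert (Hk : forall k : nat, e n <= e (Z.of_nat (S k) * n)%Z).
      { induction k as [|k IH]; [replace (Z.of_nat 1 * n)%Z with n by lia; lra|].
        eapply Rle_trans; [exact IH|].
        replace (Z.of_nat (S (S k)) * n)%Z with (Z.of_nat (S k) * n + n)%Z by lia.
        apply Hmono. }
      (* After [2 * N] jumps by [n] the index is a multiple of the period, so [e n <= e 0 = 0],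
         whereas [n < N] makes [e n] positive. *)
      specialize (Hk (2 * N - 1)%nat).
      replace (Z.of_nat (S (2 * N - 1)) * n)%Z with (0 + n * (2 * Z.of_nat N))%Z in Hk by lia.
      rewrite Eper, E0 in Hk. lra.
Qed.

(** Two orbits are separated at the half-period of the shorter one: its correction vanishes there,
    and that of the longer one lies strictly between 0 and [PI / w]. *)
Lemma infinitely_many_nonBirkhoff (w d : R) (m n : Z) :
  admissible w d -> w = IZR n -> (1 <= m)%Z -> (m <= n - 1)%Z ->
  exists orbits : nat -> (Z -> pt),
    (forall k1 k2, k1 <> k2 -> orbits k1 <> orbits k2) /\
    forall k, nonBirkhoff_periodic_orbit (fun x => crv w d (2 * PI * x))
      (IZR m / IZR n) (orbits k).
Proof.
  intros H Hwn Hm1 Hm2. pose proof PI_RGT_0 as HPI.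
  pose proof (admissible_w_ge1 w d H) as Hw1. assert (Hw : w <> 0) by lra.
  assert (Hm2' := IZR_le _ _ Hm2). rewrite minus_IZR, <- Hwn in Hm2'.
  destruct (billiard_chain w d m H Hm1 Hm2') as [N0 HN0].
  (* Long enough for a chain to exist, and longer than [n], so that index [n] is an inner one. *)
  set (len := fun k => (N0 + Z.to_nat n + 1 + k)%nat).
  assert (Hlen : forall k, (N0 <= len k)%nat) by (intros; unfold len; lia).
  set (sol := fun k => constructive_indefinite_description _ (HN0 (len k) (Hlen k))).
  set (y := fun k => proj1_sig (sol k)).
  assert (Hy : forall k, y k O = 0 /\ y k (len k) = 0 /\
    forall i, (S i < len k)%nat -> 0 < y k (S i) < PI / w /\
      inc w d (y k i - 2 * PI * IZR m / w) (y k (S i))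
      + inc w d (y k (S (S i)) + 2 * PI * IZR m / w) (y k (S i)) = 0)
    by (intros k; exact (proj2_sig (sol k))).
  exists (fun k i => crv w d (angle (2 * PI * IZR m / w) (odd_ext (y k) (len k)) i)). split.
  - assert (Hlt : forall k1 k2, (k1 < k2)%nat ->
      (fun i => crv w d (angle (2 * PI * IZR m / w) (odd_ext (y k1) (len k1)) i))
      <> (fun i => crv w d (angle (2 * PI * IZR m / w) (odd_ext (y k2) (len k2)) i))).
    { intros k1 k2 Hk E. apply (f_equal (fun f => f (Z.of_nat (len k1)))) in E. cbv beta in E.
      assert (Hl : (len k1 < len k2)%nat) by (unfold len; lia).
      assert (Hp : (0 < len k1)%nat) by (unfold len; lia).
      destruct (Hy k1) as (_ & A1 & _). destruct (Hy k2) as (_ & _ & A2).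
      destruct (crv_inj w d _ _ H E) as [k Ek]. unfold angle in Ek.
      rewrite !odd_ext_nat, A1 in Ek by lia.
      destruct (len k1) as [|j]; [lia|]. destruct (A2 j ltac:(lia)) as [A3 _].
      assert (PI / w <= PI).
      { apply Rle_div_l; nra. }
      apply (no_Z_multiple_2PI (y k2 (S j)) k); lra. }
    intros k1 k2 Hne. destruct (Nat.lt_total k1 k2) as [L|[L|L]]; [now apply Hlt|lia|].
    intros E. symmetry in E. exact (Hlt _ _ L E).
  - intros k. destruct (Hy k) as (A0 & A1 & A2).
    apply nonBirkhoff_odd_orbit; trivial. unfold len. lia.
Qed.

(** * Closeness to the circle on the strip *)

Lemma Ccos_RtoC (x : R) : Ccos (RtoC x) = RtoC (cos x).
Proof.
  unfold Ccos, RtoC; simpl. rewrite cosh_0, sinh_0. f_equal; ring.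
Qed.

Lemma Csin_RtoC (x : R) : Csin (RtoC x) = RtoC (sin x).
Proof.
  unfold Csin, RtoC; simpl. rewrite cosh_0, sinh_0. f_equal; ring.
Qed.

Lemma Im_RtoC_mult (a : R) (z : C) : Im (RtoC a * z) = a * Im z.
Proof. unfold Im, RtoC; simpl. ring. Qed.

Lemma C2norm_le (a b : C) (r : R) : Cmod a <= r -> Cmod b <= r -> C2norm a b <= 2 * r.
Proof.
  intros Ha Hb. pose proof (Cmod_ge_0 a). pose proof (Cmod_ge_0 b).
  unfold C2norm. rewrite <- (sqrt_square (2 * r)) by lra. apply sqrt_le_1_alt. nra.
Qed.

(** Each coordinate differs from that of the circle by [d] times products of one function of
    frequency 1 and one of frequency [w]; on the strip these grow at most like [exp (2 * PI * rho)]
    and [exp (2 * PI * rho * w)]. The leading 2 bounds the norm of a pair by its coordinates. *)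
Lemma crv_holo_close (w d rho eps : R) :
  0 <= w -> 0 < d -> 0 < rho ->
  2 * d * ((1 + w) * exp (2 * PI * rho * (1 + w))) < eps ->
  holo_close_on_strip (fun x => crv w d (2 * PI * x)) rho eps.
Proof.
  intros Hw Hd Hrho Heps. pose proof PI_RGT_0 as HPI.
  set (z1 := fun z : C => (RtoC (2 * PI) * z)%C).
  set (zw := fun z : C => (RtoC w * z1 z)%C).
  exists (fun z => gamma0C1 z + RtoC (- d) *
    (Ccos (zw z) * Ccos (z1 z) + RtoC w * (Csin (zw z) * Csin (z1 z))))%C.
  exists (fun z => gamma0C2 z + RtoC (- d) *
    (Ccos (zw z) * Csin (z1 z) + RtoC (- w) * (Csin (zw z) * Ccos (z1 z))))%C.
  (* The extensions are entire, so any larger strip will do. *)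
  exists (rho + 1). split; [lra|]. split; [|split].
  - intros z _.
    assert (A1 : holo z1 z) by (apply holo_mult; [apply holo_const|apply holo_id]).
    assert (Aw : holo zw z) by (apply holo_mult; [apply holo_const|exact A1]).
    pose proof (holo_Ccos_comp z1 z A1) as C1. pose proof (holo_Csin_comp z1 z A1) as S1.
    pose proof (holo_Ccos_comp zw z Aw) as Cw. pose proof (holo_Csin_comp zw z Aw) as Sw.
    split; apply holo_Cholo_at.
    + exact (holo_plus _ _ z C1 (holo_mult _ _ z (holo_const _ z)
        (holo_plus _ _ z (holo_mult _ _ z Cw C1)
          (holo_mult _ _ z (holo_const _ z) (holo_mult _ _ z Sw S1))))).
    + exact (holo_plus _ _ z S1 (holo_mult _ _ z (holo_const _ z)
        (holo_plus _ _ z (holo_mult _ _ z Cw S1)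
          (holo_mult _ _ z (holo_const _ z) (holo_mult _ _ z Sw C1))))).
  - intros x.
    assert (E1 : z1 (RtoC x) = RtoC (2 * PI * x)) by (unfold z1; now rewrite <- RtoC_mult).
    assert (Ew : zw (RtoC x) = RtoC (w * (2 * PI * x)))
      by (unfold zw; now rewrite E1, <- RtoC_mult).
    unfold gamma0C1, gamma0C2. fold (z1 (RtoC x)).
    rewrite E1, Ew, !Ccos_RtoC, !Csin_RtoC.
    rewrite <- !RtoC_mult, <- !RtoC_plus, <- !RtoC_mult, <- !RtoC_plus.
    split; f_equal; unfold crv, supp, supp'; simpl; ring.
  - exists (2 * (d * ((1 + w) * exp (2 * PI * rho * (1 + w))))). split; [lra|].
    intros z Hz.
    assert (B1 : Rabs (Im (z1 z)) <= 2 * PI * rho).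
    { unfold z1. rewrite Im_RtoC_mult, Rabs_mult, Rabs_pos_eq by lra.
      apply Rmult_le_compat_l; lra. }
    assert (Bw : Rabs (Im (zw z)) <= 2 * PI * rho * w).
    { unfold zw. rewrite Im_RtoC_mult, Rabs_mult, Rabs_pos_eq by lra. nra. }
    set (X := exp (2 * PI * rho)). set (Y := exp (2 * PI * rho * w)).
    assert (EXY : exp (2 * PI * rho * (1 + w)) = X * Y)
      by (unfold X, Y; rewrite <- exp_plus; f_equal; ring).
    assert (C1 : Cmod (Ccos (z1 z)) <= X)
      by (eapply Rle_trans; [apply Cmod_Ccos_le|now apply exp_le_mono]).
    assert (S1 : Cmod (Csin (z1 z)) <= X)
      by (eapply Rle_trans; [apply Cmod_Csin_le|now apply exp_le_mono]).
    assert (Cw : Cmod (Ccos (zw z)) <= Y)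
      by (eapply Rle_trans; [apply Cmod_Ccos_le|now apply exp_le_mono]).
    assert (Sw : Cmod (Csin (zw z)) <= Y)
      by (eapply Rle_trans; [apply Cmod_Csin_le|now apply exp_le_mono]).
    assert (Bd : forall a b a' b' v, Rabs v = w -> Cmod a <= Y -> Cmod b <= X ->
      Cmod a' <= Y -> Cmod b' <= X ->
      Cmod (RtoC (- d) * (a * b + RtoC v * (a' * b'))) <= d * ((1 + w) * (X * Y))).
    { intros a b a' b' v Hv Ha Hb Ha' Hb'.
      rewrite Cmod_mult, Cmod_R, Rabs_Ropp, Rabs_pos_eq by lra.
      apply Rmult_le_compat_l; [lra|].
      eapply Rle_trans; [apply Cmod_triangle|].
      rewrite !Cmod_mult, Cmod_R, Hv.
      pose proof (Cmod_ge_0 a). pose proof (Cmod_ge_0 b).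
      pose proof (Cmod_ge_0 a'). pose proof (Cmod_ge_0 b').
      pose proof (Rmult_le_compat (Cmod a) Y (Cmod b) X).
      pose proof (Rmult_le_compat (Cmod a') Y (Cmod b') X).
      assert (w * (Cmod a' * Cmod b') <= w * (Y * X)) by (apply Rmult_le_compat_l; auto).
      lra. }
    rewrite EXY.
    apply C2norm_le.
    + replace (_ - _)%C with (RtoC (- d) * (Ccos (zw z) * Ccos (z1 z)
        + RtoC w * (Csin (zw z) * Csin (z1 z))))%C by ring.
      apply Bd; trivial. now apply Rabs_pos_eq.
    + replace (_ - _)%C with (RtoC (- d) * (Ccos (zw z) * Csin (z1 z)
        + RtoC (- w) * (Csin (zw z) * Ccos (z1 z))))%C by ring.
      apply Bd; trivial. rewrite Rabs_Ropp. now apply Rabs_pos_eq.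
Qed.

Theorem mainTheorem5 (m n : Z) :
  (1 <= m)%Z -> (m <= n - 1)%Z -> Z.gcd m n = 1%Z ->
  forall rho eps : R, 0 < rho -> 0 < eps ->
  exists gamma : R -> pt,
    holo_close_on_strip gamma rho eps /\
    simple_closed_param gamma /\
    (exists D : pt -> Prop, strictly_convex_domain D /\ bounds gamma D) /\
    exists orbits : nat -> (Z -> pt),
      (forall k1 k2, k1 <> k2 -> orbits k1 <> orbits k2) /\
      forall k, nonBirkhoff_periodic_orbit gamma (IZR m / IZR n) (orbits k).
Proof.
  intros Hm1 Hm2 _ rho eps Hrho Heps. pose proof PI_RGT_0 as HPI.
  set (w := IZR n).
  assert (Hw : 1 <= w) by (apply IZR_le; lia).
  set (K := (1 + w) * exp (2 * PI * rho * (1 + w))).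
  assert (HK : 0 < K) by (apply Rmult_lt_0_compat; [lra|apply exp_pos]).
  assert (Hw3 : 0 < 4 * w ^ 3) by (apply Rmult_lt_0_compat; [lra|apply pow_lt; lra]).
  (* The first bound gives admissibility. The second yields [2 * d * K <= eps / 2], hence the strict
     inequality required for closeness. *)
  set (d := Rmin (/ (4 * w ^ 3)) (eps / (4 * K))).
  assert (Hd : 0 < d).
  { apply Rmin_pos; [now apply Rinv_0_lt_compat|apply Rdiv_lt_0_compat; lra]. }
  assert (Hd1 : d * (4 * w ^ 3) <= 1).
  { rewrite <- (Rinv_l (4 * w ^ 3)) by lra. apply Rmult_le_compat_r; [lra|apply Rmin_l]. }
  assert (Hd2 : d * (4 * K) <= eps) by (apply Rle_div_r; [lra|apply Rmin_r]).
  assert (H : admissible w d).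
  { split; [exact Hd|]. split; [lra|]. exists (Z.to_nat n). split; [lia|].
    rewrite INR_IZR_INZ, Z2Nat.id by lia. reflexivity. }
  exists (fun x => crv w d (2 * PI * x)). split; [|split; [|split]].
  - apply crv_holo_close; try lra. fold K. lra.
  - now apply crv_simple_closed.
  - exists (dom w d). split; [now apply dom_strictly_convex|].
    intros q. rewrite (bounds_dom w d q H). split.
    + intros [t <-]. exists (t / (2 * PI)). f_equal. field. lra.
    + intros [t <-]. now exists (2 * PI * t).
  - now apply infinitely_many_nonBirkhoff.
Qed.
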